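(* Let $n\in\mathbb{N}$ ($n=0$ allowed). Fix pairwise distinct points $z_1,\ldots,z_{n+1}\in\mathbb{D}$ and interpolation values $w_1,\ldots,w_{n+1}\in\overline{\mathbb{D}}$, and suppose that all the hyperbolic divided differences satisfy $\Delta_j^k\in\mathbb{D}$ for $0\le k<j\le n+1$. Then for each fixed $z\in\mathbb{D}\setminus\{z_1,\ldots,z_{n+1}\}$, the region of values $$\{f(z): f\in\mathcal{S},\ f(z_j)=w_j \text{ for } 1\le j\le n+1\}$$ is the closed disk $$\overline{\mathbb{D}}(c(z),\rho(z))=\{f_\varepsilon(z):\varepsilon\in\overline{\mathbb{D}}\},$$ where $$c(z)=\frac{\overline{B_n(z)}\,\widetilde{B}_n(z)-|T_{-z_{n+1}}(z)|^2\,\overline{A_n(z)}\,\widetilde{A}_n(z)}{|B_n(z)|^2-|T_{-z_{n+1}}(z)|^2|A_n(z)|^2},\qquad \rho(z)=\frac{\prod_{k=0}^n\left\{|T_{-z_{k+1}}(z)|\,(1-|\Delta_{k+1}^k|^2)\right\}}{|B_n(z)|^2-|T_{-z_{n+1}}(z)|^2|A_n(z)|^2}.$$ Furthermore, for $f\in\mathcal{S}$ with $f(z_j)=w_j$ ($1\le j\le n+1$), one has $f(z)\in\partial\mathbb{D}(c(z),\rho(z))$ if and only if $f\equiv f_\varepsilon$ for some $\varepsilon\in\partial\mathbb{D}$.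
   Context: $\mathbb{D}=\{|z|<1\}$; $\mathbb{D}(c,\rho)$ and $\overline{\mathbb{D}}(c,\rho)$ are the open and closed disks with center $c$ and radius $\rho$; $\mathcal{S}$ is the Schur class of analytic functions $f$ on $\mathbb{D}$ with $|f|\le 1$. For $a\in\mathbb{D}$, $T_a(z)=(z+a)/(1+\bar a z)$. For $z,w\in\overline{\mathbb{D}}$, $[z,w]=\frac{z-w}{1-\overline{w}z}$ if $z\overline{w}\ne1$ and $[z,w]=\infty$ if $z\overline{w}=1$. Hyperbolic divided differences: $\Delta_j^0:=w_j$ for $j=1,\ldots,n+1$, and for $1\le k\le n$, $j=k+1,\ldots,n+1$, $\Delta_j^k:=\frac{[\Delta_j^{k-1},\Delta_k^{k-1}]}{[z_j,z_k]}$ if $|[\Delta_j^{k-1},\Delta_k^{k-1}]|\le|[z_j,z_k]|$, $\Delta_j^k:=0$ if $\Delta_j^{k-1}=\Delta_k^{k-1}\in\partial\mathbb{D}$, and $\Delta_j^k:=\infty$ in all other cases. Rational functions $A_k,\widetilde A_k,B_k,\widetilde B_k$ ($k=0,\ldots,n$) are defined by $$\begin{pmatrix} A_0 & \widetilde A_0 \\ B_0 & \widetilde B_0 \end{pmatrix}=\begin{pmatrix} \overline{\Delta_1^0} & 1 \\ 1 & \Delta_1^0 \end{pmatrix},\qquad \begin{pmatrix} A_{k+1}(z) & \widetilde A_{k+1}(z) \\ B_{k+1}(z) & \widetilde B_{k+1}(z) \end{pmatrix}=\begin{pmatrix} T_{-z_{k+1}}(z) & \overline{\Delta_{k+2}^{k+1}}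 \\ T_{-z_{k+1}}(z)\Delta_{k+2}^{k+1} & 1 \end{pmatrix}\begin{pmatrix} A_k(z) & \widetilde A_k(z) \\ B_k(z) & \widetilde B_k(z) \end{pmatrix}$$ for $k=0,\ldots,n-1$. For $\varepsilon\in\overline{\mathbb{D}}$ and $z\in\mathbb{D}$, $$f_\varepsilon(z)=T_{\Delta_1^0}(T_{-z_1}(z)\,T_{\Delta_2^1}(\cdots T_{-z_n}(z)\,T_{\Delta_{n+1}^n}(\varepsilon T_{-z_{n+1}}(z))\cdots)).$$ *)

(* Defs.v *)
From Stdlib Require Import Reals Lia.
From Coquelicot Require Import Coquelicot.

Local Open Scope C_scope.

Definition unit_disk (z : C) : Prop := (Cmod z < 1)%R.
Definition closed_unit_disk (z : C) : Prop := (Cmod z <= 1)%R.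
Definition unit_circle (z : C) : Prop := Cmod z = 1%R.
Definition closed_disk (c : C) (r : R) (v : C) : Prop := (Cmod (v - c) <= r)%R.
Definition circle (c : C) (r : R) (v : C) : Prop := Cmod (v - c) = r.

(* Analytic means complex differentiable at every point of the open unit disk.
   The values of [f] outside the disk are unconstrained, so functions in the
   class have to be compared on [unit_disk] only. *)
Definition Schur (f : C -> C) : Prop :=
  forall z : C, unit_disk z ->
    ex_derive (K := C_AbsRing) (V := C_NormedModule) f z /\
    closed_unit_disk (f z).

Definition T (a z : C) : C := (z + a) / (1 + Cconj a * z).

(* The extended plane: [None] is the point at infinity. *)
Definition extC : Type := option C.

Definition ext_mod (x : extC) : Rbar :=
  match x with Some c => Finite (Cmod c) | None => p_infty end.

(* Junk value 0 at infinity. *)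
Definition ext_val (x : extC) : C :=
  match x with Some c => c | None => RtoC 0 end.

Definition ext_in_unit_disk (x : extC) : Prop :=
  match x with Some c => unit_disk c | None => False end.

Definition bracket (z w : C) : extC :=
  if Ceq_dec (z * Cconj w) 1 then None
  else Some ((z - w) / (1 - Cconj w * z)).

Definition hdd_step (zj zk dj dk : C) : extC :=
  let p := bracket dj dk in
  let q := bracket zj zk in
  if Rbar_le_dec (ext_mod p) (ext_mod q) then Some (ext_val p / ext_val q)
  else if Ceq_dec dj dk then
    if Req_EM_T (Cmod dj) 1 then Some (RtoC 0) else None
  else None.

(* [hdd z w k j] is the hyperbolic divided difference with upper index [k]
   and lower index [j], meaningful for k < j.  Points and values are indexed
   from 1.  If one of the previous differences is infinite, the new one falls
   under "all other cases" and is infinite. *)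
Fixpoint hdd (z w : nat -> C) (k j : nat) : extC :=
  match k with
  | O => Some (w j)
  | S k' =>
      match hdd z w k' j, hdd z w k' k with
      | Some dj, Some dk => hdd_step (z j) (z k) dj dk
      | _, _ => None
      end
  end.

(* [gamma z w k] is the finite value of the diagonal difference with upper
   index [k] and lower index [k + 1]. *)
Definition gamma (z w : nat -> C) (k : nat) : C := ext_val (hdd z w k (S k)).

(* Rows (A_k, A~_k) and (B_k, B~_k), evaluated at [x]. *)
Fixpoint AB (z w : nat -> C) (k : nat) (x : C) : @matrix C 2 2 :=
  match k with
  | O => [[Cconj (gamma z w 0), RtoC 1],
          [RtoC 1, gamma z w 0]]
  | S k' =>
      let t := T (- z k) x in
      @Mmult C_Ring 2 2 2
        [[t, Cconj (gamma z w k)],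
         [t * gamma z w k, RtoC 1]]
        (AB z w k' x)
  end.

Definition A z w k x : C := coeff_mat (RtoC 0) (AB z w k x) 0 0.
Definition At z w k x : C := coeff_mat (RtoC 0) (AB z w k x) 0 1.
Definition B z w k x : C := coeff_mat (RtoC 0) (AB z w k x) 1 0.
Definition Bt z w k x : C := coeff_mat (RtoC 0) (AB z w k x) 1 1.

(* The [m] nested layers with indices k, k + 1, ..., k + m - 1; layer [i] is
   u |-> T_{gamma_i} (T_{- z_{i+1}} (x) * u), and [eps] is at the centre. *)
Fixpoint layers (z w : nat -> C) (eps x : C) (m k : nat) : C :=
  match m with
  | O => eps
  | S m' => T (gamma z w k) (T (- z (S k)) x * layers z w eps x m' (S k))
  end.

Definition f_eps (z w : nat -> C) (n : nat) (eps x : C) : C :=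
  layers z w eps x (S n) 0.

Definition denom (z w : nat -> C) (n : nat) (x : C) : R :=
  (Cmod (B z w n x) ^ 2
   - Cmod (T (- z (S n)) x) ^ 2 * Cmod (A z w n x) ^ 2)%R.

Definition center (z w : nat -> C) (n : nat) (x : C) : C :=
  (Cconj (B z w n x) * Bt z w n x
   - RtoC (Cmod (T (- z (S n)) x) ^ 2) * (Cconj (A z w n x) * At z w n x))
  / RtoC (denom z w n x).

Definition radius (z w : nat -> C) (n : nat) (x : C) : R :=
  (prod_f_R0 (fun k => Cmod (T (- z (S k)) x) * (1 - Cmod (gamma z w k) ^ 2)) n
   / denom z w n x)%R.

Definition interpolates (z w : nat -> C) (n : nat) (f : C -> C) : Prop :=
  forall j : nat, (1 <= j <= n + 1)%nat -> f (z j) = w j.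

(* Main.v *)
Require Import Defs.
From Stdlib Require Import Reals.
From Stdlib Require Import Lra Lia List Classical ClassicalEpsilon.
From Coquelicot Require Import Coquelicot.

(* Peeling off one interpolation node at a time, f_(k+1) = [f_k, gamma_k] / [., z_(k+1)],
   the Schwarz-Pick lemma turns an interpolant f into a function f_(n+1) bounded
   by 1, and f(x) is the value at eps = f_(n+1)(x) of the Moebius transformation
   eps |-> (t A~_n eps + B~_n) / (t A_n eps + B_n), t = T_(-z_(n+1))(x), which maps the
   closed unit disk onto the closed disk with the stated centre and radius.  A
   boundary value forces |f_(n+1)(x)| = 1, so f_(n+1) is constant.

   Only differentiability is assumed, not continuity of the derivative.  Goursat's
   bisection argument on rectangles in the coordinate log z shows that circular
   means are constant, hence |F(0)| <= max |F| on circles.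
   The functions f_k are only controlled off finitely many points; instead of
   removing singularities, this inequality is applied to P^2 g^N, where P vanishes
   at the exceptional points, and the N-th root is taken as N grows. *)

(** The exceptional points come from the division: at its own node the quotient defining f_(k+1) is
    0 * / 0 = 0, whatever the derivative of f_k there, so f_(k+1) may be discontinuous at z_(k+1).
    The factor P is squared because |P^2 g^N| is then at most a constant times the squared distance
    to a zero of P, which gives derivative 0 there; one factor P would only give continuity. Complex
    integration has to deliver one inequality at the centre 0 and nothing else, since the
    automorphism T_z carries 0 to any prescribed z. In the coordinate log z circles become vertical
    segments, so axis-parallel rectangles are the only contours needed. On the algebraic side, the
    nested formula and the matrix recursion describe the same map of eps; the determinant of the
    matrices gives the numerator of the radius. *)

Local Open Scope R_scope.

(** * Complex derivatives *)

Lemma ex_derive_C_epsilon (f : C -> C) (z : C) :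
  ex_derive (K := C_AbsRing) (V := C_NormedModule) f z <->
  exists l : C, forall eta : posreal, exists delta : posreal, forall y : C,
    Cmod (y - z)%C < delta ->
    Cmod (f y - f z - l * (y - z))%C <= eta * Cmod (y - z)%C.
Proof.
  split.
  - intros [l [_ H]]; exists l; intros eta.
    destruct (H z (fun P HP => HP) eta) as [d Hd].
    exists d; intros y Hy.
    specialize (Hd y Hy).
    rewrite (Cmult_comm l). exact Hd.
  - intros [l H]; exists l; split.
    + apply (is_linear_scal_l (K := C_AbsRing) (V := C_NormedModule)).
    + intros x Hx eta.
      rewrite <- (is_filter_lim_locally_unique _ _ Hx).
      destruct (H eta) as [d Hd]; exists d; intros y Hy.
      specialize (Hd y Hy). rewrite (Cmult_comm l) in Hd. exact Hd.
Qed.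

Notation C_ex_derive := (ex_derive (K := C_AbsRing) (V := C_NormedModule)).

(* [C_NormedModule] and [AbsRing_NormedModule C_AbsRing] have the same norm but
   are not convertible; the algebraic rules for derivatives live on the latter. *)
Lemma C_ex_derive_AbsRing (f : C -> C) (z : C) :
  C_ex_derive f z <->
  ex_derive (K := C_AbsRing) (V := AbsRing_NormedModule C_AbsRing) f z.
Proof.
  split; intros [l [[H1 H2 H3] H4]]; exists l; (split; [split; auto | exact H4]).
Qed.

Lemma C_ex_derive_const (a z : C) : C_ex_derive (fun _ => a) z.
Proof. exact (ex_derive_const (K := C_AbsRing) (V := C_NormedModule) a z). Qed.

Lemma C_ex_derive_id (z : C) : C_ex_derive (fun y => y) z.
Proof. apply C_ex_derive_AbsRing, (ex_derive_id (K := C_AbsRing)). Qed.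

Lemma C_ex_derive_plus (f g : C -> C) (z : C) :
  C_ex_derive f z -> C_ex_derive g z -> C_ex_derive (fun y => f y + g y)%C z.
Proof. exact (ex_derive_plus (K := C_AbsRing) (V := C_NormedModule) f g z). Qed.

Lemma C_ex_derive_minus (f g : C -> C) (z : C) :
  C_ex_derive f z -> C_ex_derive g z -> C_ex_derive (fun y => f y - g y)%C z.
Proof. exact (ex_derive_minus (K := C_AbsRing) (V := C_NormedModule) f g z). Qed.

Lemma C_ex_derive_mult (f g : C -> C) (z : C) :
  C_ex_derive f z -> C_ex_derive g z -> C_ex_derive (fun y => f y * g y)%C z.
Proof.
  rewrite !C_ex_derive_AbsRing. intros [lf Hf] [lg Hg]. eexists.
  exact (is_derive_mult (K := C_AbsRing) f g z lf lg Hf Hg Cmult_comm).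
Qed.

Lemma C_ex_derive_comp (f g : C -> C) (z : C) :
  C_ex_derive f (g z) -> C_ex_derive g z -> C_ex_derive (fun y => f (g y)) z.
Proof.
  intros Hf Hg. apply C_ex_derive_AbsRing in Hg.
  exact (ex_derive_comp (K := C_AbsRing) (V := C_NormedModule) f g z Hf Hg).
Qed.

Lemma C_ex_derive_continuous (f : C -> C) (z : C) :
  C_ex_derive f z -> forall eta : posreal, exists delta : posreal,
    forall y, Cmod (y - z)%C < delta -> Cmod (f y - f z)%C < eta.
Proof.
  rewrite C_ex_derive_AbsRing. intros Hf eta.
  pose proof (ex_derive_continuous (K := C_AbsRing)
    (V := AbsRing_NormedModule C_AbsRing) f z Hf) as H.
  destruct (proj1 (filterlim_locally _ _) H eta) as [d Hd].
  exists d; intros y Hy. exact (Hd y Hy).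
Qed.

Lemma C_ex_derive_inv (z : C) : z <> 0 -> C_ex_derive Cinv z.
Proof.
  intros Hz. apply ex_derive_C_epsilon. exists (- / (z * z))%C.
  intros eta. assert (Hm : 0 < Cmod z) by now apply Cmod_gt_0.
  set (m := Cmod z) in *.
  (* The remainder of / y at z is |y - z|^2 / (|y| m^2). Staying within m / 2 of z keeps |y| >= m /
     2, so |y - z| < eta m^3 / 2 makes it at most eta |y - z|. *)
  assert (Hd : 0 < Rmin (m / 2) (eta * (m ^ 3 / 2))).
  { pose proof (cond_pos eta). apply Rmin_case; [lra|].
    apply Rmult_lt_0_compat; [lra|]. pose proof (pow_lt m 3 Hm). lra. }
  exists (mkposreal _ Hd); intros y Hy; simpl in Hy.
  assert (H1 : Cmod (y - z)%C < m / 2)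
    by (eapply Rlt_le_trans; [exact Hy | apply Rmin_l]).
  assert (H2 : Cmod (y - z)%C < eta * (m ^ 3 / 2))
    by (eapply Rlt_le_trans; [exact Hy | apply Rmin_r]).
  assert (H3 : m / 2 <= Cmod y).
  { pose proof (Cmod_triangle y (- (y - z))%C) as Ht.
    rewrite Cmod_opp in Ht. replace (y + - (y - z))%C with z in Ht by ring.
    fold m in Ht. lra. }
  assert (Hy0 : y <> 0) by (apply Cmod_gt_0; lra).
  replace (/ y - / z - - / (z * z) * (y - z))%C
    with ((y - z) * (y - z) / (y * (z * z)))%C by (field; auto).
  rewrite Cmod_div, !Cmod_mult by (repeat apply Cmult_neq_0; auto).
  fold m. set (q := Cmod (y - z)%C) in *.
  assert (Hq : 0 <= q) by apply Cmod_ge_0.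
  assert (Hp : 0 < Cmod y * (m * m)) by (apply Rmult_lt_0_compat; nra).
  apply Rmult_le_reg_r with (1 := Hp).
  unfold Rdiv. rewrite Rmult_assoc, Rinv_l, Rmult_1_r by lra.
  rewrite (Rmult_comm eta), Rmult_assoc. apply Rmult_le_compat_l; [exact Hq|].
  apply Rle_trans with (1 := Rlt_le _ _ H2).
  apply Rmult_le_compat_l; [apply Rlt_le, cond_pos|]. nra.
Qed.

Lemma C_ex_derive_div (f g : C -> C) (z : C) :
  C_ex_derive f z -> C_ex_derive g z -> g z <> 0 ->
  C_ex_derive (fun y => f y / g y)%C z.
Proof.
  intros Hf Hg H0. apply C_ex_derive_mult; [exact Hf|].
  apply (C_ex_derive_comp Cinv g); [now apply C_ex_derive_inv | exact Hg].
Qed.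

Lemma C_ex_derive_pow (f : C -> C) (z : C) (N : nat) :
  C_ex_derive f z -> C_ex_derive (fun y => f y ^ N)%C z.
Proof.
  intros Hf. induction N as [|N IH]; simpl.
  - apply C_ex_derive_const.
  - now apply C_ex_derive_mult.
Qed.

(** * Goursat's theorem on rectangles *)

Section Bisection.
(** [P a c t] is read as a property of the rectangle with lower left corner (a, c) and sides t L1, t
    L2. Fixing the shape lets the single scale t control both sides. A property inherited from the
    four quarters and valid on all small rectangles around each point must hold everywhere, since a
    failure would shrink to a point. *)
Variables (L1 L2 : R) (P : R -> R -> R -> Prop).
Hypotheses (HL1 : 0 <= L1) (HL2 : 0 <= L2).
Hypothesis Hglue : forall a c t, 0 < t ->
  P a c (t / 2) -> P (a + t / 2 * L1) c (t / 2) ->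
  P a (c + t / 2 * L2) (t / 2) -> P (a + t / 2 * L1) (c + t / 2 * L2) (t / 2) ->
  P a c t.
Hypothesis Hlocal : forall p q, exists delta : posreal, forall a c t,
  0 < t < delta -> a <= p <= a + t * L1 -> c <= q <= c + t * L2 -> P a c t.

Let bad (t : R) (ac : R * R) := ~ P (fst ac) (snd ac) t.

Lemma bisection_next (t : R) (ac : R * R) : 0 < t -> bad t ac ->
  exists ac' : R * R, bad (t / 2) ac' /\
    fst ac <= fst ac' <= fst ac + t / 2 * L1 /\
    snd ac <= snd ac' <= snd ac + t / 2 * L2.
Proof.
  destruct ac as [a c]; unfold bad; simpl; intros Ht H.
  assert (0 <= t / 2 * L1) by (apply Rmult_le_pos; lra).
  assert (0 <= t / 2 * L2) by (apply Rmult_le_pos; lra).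
  apply NNPP; intros Hn. apply H, Hglue; [exact Ht|..]; apply NNPP; intros HP;
    apply Hn; eexists (_, _); (split; [exact HP|]); simpl; lra.
Qed.

Lemma bisection (a c t : R) : 0 < t -> P a c t.
Proof.
  intros Ht. apply NNPP; intros Hbad.
  assert (Hpow : forall n, 0 < t / 2 ^ n)
    by (intros n; apply Rdiv_lt_0_compat; [exact Ht | apply pow_lt; lra]).
  assert (Hhalf : forall n, t / 2 ^ n / 2 = t / 2 ^ S n)
    by (intros n; simpl; field; apply pow_nonzero; lra).
  (* [epsilon] is total, so the sequence of corners can be defined before any corner is known to be
     bad; [Hstep] recovers the specification along the sequence. *)
  pose (next := fun n (ac : R * R) =>
    epsilon (inhabits ac) (fun ac' => bad (t / 2 ^ S n) ac' /\
      fst ac <= fst ac' <= fst ac + t / 2 ^ S n * L1 /\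
      snd ac <= snd ac' <= snd ac + t / 2 ^ S n * L2)).
  pose (u := fix u n := match n with O => (a, c) | S n' => next n' (u n') end).
  assert (Hstep : forall n, bad (t / 2 ^ n) (u n) -> bad (t / 2 ^ S n) (u (S n)) /\
      fst (u n) <= fst (u (S n)) <= fst (u n) + t / 2 ^ S n * L1 /\
      snd (u n) <= snd (u (S n)) <= snd (u n) + t / 2 ^ S n * L2).
  { intros n Hb. change (u (S n)) with (next n (u n)).
    apply epsilon_spec. rewrite <- Hhalf. now apply bisection_next. }
  assert (Hb : forall n, bad (t / 2 ^ n) (u n)).
  { induction n as [|n IH]; [|now apply Hstep].
    unfold bad; simpl. now rewrite Rdiv_1_r. }
  assert (Hs := fun n => proj2 (Hstep n (Hb n))).
  (* The upper right corners decrease while the lower left corners increase. *)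
  assert (Hlim : forall (v : nat -> R) (L : R), 0 <= L ->
    (forall n, v n <= v (S n) <= v n + t / 2 ^ S n * L) ->
    exists p, forall n, v n <= p <= v n + t / 2 ^ n * L).
  { intros v L HL Hv.
    assert (Hincr : forall n k, v n <= v (n + k)%nat).
    { intros n k; induction k; [rewrite Nat.add_0_r; lra|].
      rewrite Nat.add_succ_r. specialize (Hv (n + k)%nat). lra. }
    assert (Hdecr : forall n k, v (n + k)%nat + t / 2 ^ (n + k) * L <= v n + t / 2 ^ n * L).
    { intros n k; induction k; [rewrite Nat.add_0_r; lra|].
      rewrite Nat.add_succ_r. specialize (Hv (n + k)%nat).
      rewrite <- Hhalf in *. lra. }
    assert (Hpos : forall n, 0 <= t / 2 ^ n * L)
      by (intros n; apply Rmult_le_pos; [apply Rlt_le, Hpow | exact HL]).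
    destruct (ex_finite_lim_seq_incr v (v O + t / 2 ^ O * L)) as [p Hp].
    - intros n; apply Hv.
    - intros n. pose proof (Hdecr O n). pose proof (Hpos n). simpl in *. lra.
    - exists p; intros n; split.
      + apply (is_lim_seq_incr_compare v p Hp). intros m; apply Hv.
      + apply (is_lim_seq_incr_n v n) in Hp.
        refine (is_lim_seq_le _ _ p (v n + t / 2 ^ n * L) _ Hp (is_lim_seq_const _)).
        intros k. pose proof (Hdecr n k). pose proof (Hpos (n + k)%nat).
        rewrite Nat.add_comm. lra. }
  destruct (Hlim (fun n => fst (u n)) L1 HL1 (fun n => proj1 (Hs n))) as [p Hp].
  destruct (Hlim (fun n => snd (u n)) L2 HL2 (fun n => proj2 (Hs n))) as [q Hq].
  destruct (Hlocal p q) as [d Hd].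
  assert (Hn : exists n, t / 2 ^ n < d).
  { destruct (Pow_x_infinity 2 ltac:(rewrite Rabs_pos_eq; lra) (t / d + 1)) as [n Hn].
    exists n. specialize (Hn n (le_n n)).
    rewrite Rabs_pos_eq in Hn by (apply pow_le; lra).
    pose proof (cond_pos d). pose proof (pow_lt 2 n ltac:(lra)).
    apply Rmult_lt_reg_r with (2 ^ n); [lra|].
    replace (t / 2 ^ n * 2 ^ n) with (t / d * d) by (field; lra).
    rewrite (Rmult_comm d). apply Rmult_lt_compat_r; lra. }
  destruct Hn as [n Hn]. apply (Hb n), Hd; auto.
Qed.

End Bisection.

(* Complex differentiability of [u + i v] at [p + i q], in real coordinates;
   the derivative is [l1 + i l2]. *)
Definition CR_differentiable (u v : R -> R -> R) (p q : R) : Prop :=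
  exists l1 l2 : R, forall eta : posreal, exists delta : posreal, forall x y,
    Rabs (x - p) < delta -> Rabs (y - q) < delta ->
    Rabs (u x y - u p q - (l1 * (x - p) - l2 * (y - q)))
      <= eta * (Rabs (x - p) + Rabs (y - q)) /\
    Rabs (v x y - v p q - (l2 * (x - p) + l1 * (y - q)))
      <= eta * (Rabs (x - p) + Rabs (y - q)).

Lemma linear_approx_continuous (g : R -> R) (p l : R) (delta : posreal) :
  (forall x, Rabs (x - p) < delta -> Rabs (g x - g p - l * (x - p)) <= Rabs (x - p)) ->
  continuous g p.
Proof.
  intros H. apply filterlim_locally; intros eps.
  assert (Hl : 0 < 1 + Rabs l) by (pose proof (Rabs_pos l); lra).
  assert (Hd : 0 < Rmin delta (eps / (1 + Rabs l)))
    by (apply Rmin_case; [apply cond_pos | apply Rdiv_lt_0_compat; [apply cond_pos | lra]]).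
  exists (mkposreal _ Hd); intros x Hx. change (Rabs (x - p) < Rmin delta (eps / (1 + Rabs l))) in Hx.
  change (Rabs (g x - g p) < eps).
  assert (H1 := Rlt_le_trans _ _ _ Hx (Rmin_l _ _)).
  assert (H2 := Rlt_le_trans _ _ _ Hx (Rmin_r _ _)).
  specialize (H x H1).
  pose proof (Rabs_triang (g x - g p - l * (x - p)) (l * (x - p))) as Ht.
  replace (g x - g p - l * (x - p) + l * (x - p)) with (g x - g p) in Ht by ring.
  rewrite Rabs_mult in Ht.
  apply Rmult_lt_compat_r with (r := 1 + Rabs l) in H2; [|exact Hl].
  unfold Rdiv in H2. rewrite Rmult_assoc, Rinv_l, Rmult_1_r in H2 by lra. lra.
Qed.

(** The real part of (u + i v)(dx + i dy) is u dx - v dy, so [u] is integrated along horizontal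
    sides only and [v] along vertical sides only. *)
Lemma CR_differentiable_continuous (u v : R -> R -> R) (p q : R) :
  CR_differentiable u v p q ->
  continuous (fun x => u x q) p /\ continuous (fun y => v p y) q.
Proof.
  intros [l1 [l2 H]]. destruct (H (mkposreal 1 Rlt_0_1)) as [d Hd]; simpl in Hd.
  assert (H0 : forall r, Rabs (r - r) < d)
    by (intros r; rewrite Rminus_diag, Rabs_R0; apply cond_pos).
  split.
  - apply linear_approx_continuous with l1 d; intros x Hx.
    destruct (Hd x q Hx (H0 q)) as [Hu _].
    rewrite (Rminus_diag q), Rabs_R0, Rmult_0_r, Rminus_0_r in Hu. lra.
  - apply linear_approx_continuous with l1 d; intros y Hy.
    destruct (Hd p y (H0 p) Hy) as [_ Hv].
    rewrite (Rminus_diag p), Rabs_R0, Rmult_0_r, Rplus_0_l in Hv. lra.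
Qed.

Lemma RInt_near_const (f g : R -> R) (a b k M : R) :
  a <= b -> ex_RInt f a b -> ex_RInt g a b ->
  (forall x, a <= x <= b -> Rabs (f x - g x - k) <= M) ->
  Rabs (RInt f a b - RInt g a b - (b - a) * k) <= (b - a) * M.
Proof.
  intros Hab Hf Hg H.
  apply (norm_RInt_le_const (V := R_NormedModule) (fun x => f x - g x - k) a b _ M Hab H).
  apply (is_RInt_minus (V := R_NormedModule) (fun x => f x - g x) (fun _ => k)).
  - apply (is_RInt_minus (V := R_NormedModule)); now apply (RInt_correct (V := R_CompleteNormedModule)).
  - apply (is_RInt_const (V := R_NormedModule)).
Qed.

Section Goursat.
(** The half-plane x < X stands for the logarithm of a punctured disk; it is applied with X = 0. *)
Variables (u v : R -> R -> R) (X : R).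
Hypothesis Huv : forall p q, p < X -> CR_differentiable u v p q.

Definition horizontal (y a b : R) := RInt (fun x => u x y) a b.
Definition vertical (x c d : R) := RInt (fun y => v x y) c d.

(* Real part of the integral of [u + i v] along the boundary of a rectangle. *)
Definition circulation (a b c d : R) : R :=
  horizontal c a b - horizontal d a b - vertical b c d + vertical a c d.

Lemma ex_horizontal (y a b : R) : a <= b -> b < X -> ex_RInt (fun x => u x y) a b.
Proof.
  intros Hab Hb. apply (ex_RInt_continuous (V := R_CompleteNormedModule)).
  intros x Hx. rewrite Rmin_left, Rmax_right in Hx by lra.
  eapply CR_differentiable_continuous, Huv; lra.
Qed.

Lemma ex_vertical (x c d : R) : x < X -> ex_RInt (fun y => v x y) c d.
Proof.
  intros Hx. apply (ex_RInt_continuous (V := R_CompleteNormedModule)).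
  intros y _. eapply CR_differentiable_continuous, Huv; lra.
Qed.

Lemma horizontal_Chasles (y a m b : R) : a <= m -> m <= b -> b < X ->
  horizontal y a b = horizontal y a m + horizontal y m b.
Proof.
  intros. symmetry.
  apply (RInt_Chasles (V := R_CompleteNormedModule)); apply ex_horizontal; lra.
Qed.

Lemma vertical_Chasles (x c k d : R) : x < X ->
  vertical x c d = vertical x c k + vertical x k d.
Proof.
  intros. symmetry.
  apply (RInt_Chasles (V := R_CompleteNormedModule)); apply ex_vertical; lra.
Qed.

(** The linear part of u + i v contributes l2 (b - a)(d - c) to the difference of the horizontal
    sides and the same to that of the vertical sides, and cancels. With s = (b - a) + (d - c), the
    remainders cost 2 eta s per unit length of each pair of opposite sides, 2 eta s^2 altogether. *)
Lemma circulation_local (eta : posreal) (p q : R) : p < X ->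
  exists delta : posreal, forall a b c d,
    a <= p <= b -> b < X -> c <= q <= d -> b - a + (d - c) < delta ->
    Rabs (circulation a b c d) <= 2 * eta * (b - a + (d - c)) ^ 2.
Proof.
  intros Hp. destruct (Huv p q Hp) as [l1 [l2 H]]. destruct (H eta) as [delta Hd].
  exists delta; intros a b c d Ha Hb Hc Hs.
  set (s := b - a + (d - c)) in *.
  assert (Heta := cond_pos eta).
  assert (Habs : forall x lo hi m, lo <= m <= hi -> lo <= x <= hi -> Rabs (x - m) <= hi - lo)
    by (intros; apply Rabs_le; lra).
  assert (Hbound : forall x y, a <= x <= b -> c <= y <= d ->
    Rabs (u x y - u p q - (l1 * (x - p) - l2 * (y - q))) <= eta * s /\
    Rabs (v x y - v p q - (l2 * (x - p) + l1 * (y - q))) <= eta * s).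
  { intros x y Hx Hy.
    assert (H1 := Habs x a b p Ha Hx). assert (H2 := Habs y c d q Hc Hy).
    destruct (Hd x y) as [Hu Hv]; [unfold s in *; lra | unfold s in *; lra |].
    assert (eta * (Rabs (x - p) + Rabs (y - q)) <= eta * s)
      by (apply Rmult_le_compat_l; unfold s; lra).
    lra. }
  assert (HU : Rabs (horizontal c a b - horizontal d a b - (b - a) * (l2 * (d - c)))
    <= (b - a) * (2 * (eta * s))).
  { apply RInt_near_const; [lra | apply ex_horizontal; lra .. |].
    intros x Hx. destruct (Hbound x c Hx ltac:(lra)) as [H1 _].
    destruct (Hbound x d Hx ltac:(lra)) as [H2 _].
    apply Rabs_le_between in H1. apply Rabs_le_between in H2. apply Rabs_le. nra. }
  assert (HV : Rabs (vertical b c d - vertical a c d - (d - c) * (l2 * (b - a)))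
    <= (d - c) * (2 * (eta * s))).
  { apply RInt_near_const; [lra | apply ex_vertical; lra .. |].
    intros y Hy. destruct (Hbound a y ltac:(lra) Hy) as [_ H1].
    destruct (Hbound b y ltac:(lra) Hy) as [_ H2].
    apply Rabs_le_between in H1. apply Rabs_le_between in H2. apply Rabs_le. nra. }
  apply Rabs_le_between in HU. apply Rabs_le_between in HV.
  unfold circulation. apply Rabs_le. unfold s in *. nra.
Qed.

Lemma Goursat_rectangle (a b c d : R) :
  a <= b -> b < X -> c <= d -> circulation a b c d = 0.
Proof.
  intros Hab Hb Hcd. set (s := b - a + (d - c)).
  assert (Hall : forall eta : posreal, Rabs (circulation a b c d) <= 2 * eta * s ^ 2).
  { intros eta. assert (Heta := cond_pos eta).
    (* The bound is quadratic in t, so the bounds of four quarters add up exactly to that of the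
       whole. The guard is there because [bisection] ranges over all rectangles of the plane; around
       a point with p >= X it makes [P] vacuous. *)
    pose (P := fun a' c' t : R => a' + t * (b - a) < X ->
      Rabs (circulation a' (a' + t * (b - a)) c' (c' + t * (d - c))) <= 2 * eta * (t * s) ^ 2).
    assert (HP : P a c 1).
    { apply (bisection (b - a) (d - c) P); try lra; unfold P; clear P.
      - intros a' c' t Ht.
        set (m := a' + t / 2 * (b - a)). set (k := c' + t / 2 * (d - c)).
        replace (m + t / 2 * (b - a)) with (a' + t * (b - a)) by (unfold m; field).
        replace (k + t / 2 * (d - c)) with (c' + t * (d - c)) by (unfold k; field).
        replace (2 * eta * (t * s) ^ 2) with (4 * (2 * eta * (t / 2 * s) ^ 2)) by field.
        intros H1 H2 H3 H4 HX.
        assert (Hm : a' <= m <= a' + t * (b - a)) by (unfold m; split; nra).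
        specialize (H1 ltac:(lra)). specialize (H2 HX).
        specialize (H3 ltac:(lra)). specialize (H4 HX).
        replace (circulation a' (a' + t * (b - a)) c' (c' + t * (d - c))) with
          (circulation a' m c' k + circulation m (a' + t * (b - a)) c' k +
           circulation a' m k (c' + t * (d - c)) +
           circulation m (a' + t * (b - a)) k (c' + t * (d - c))).
        2:{ unfold circulation.
            rewrite (horizontal_Chasles c' a' m (a' + t * (b - a))) by lra.
            rewrite (horizontal_Chasles (c' + t * (d - c)) a' m (a' + t * (b - a))) by lra.
            rewrite (vertical_Chasles a' c' k (c' + t * (d - c))) by lra.
            rewrite (vertical_Chasles (a' + t * (b - a)) c' k (c' + t * (d - c))) by lra.
            ring. }
        apply Rabs_le_between in H1. apply Rabs_le_between in H2.
        apply Rabs_le_between in H3. apply Rabs_le_between in H4.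
        apply Rabs_le. lra.
      - intros p q. destruct (Rlt_le_dec p X) as [Hp | Hp].
        + destruct (circulation_local eta p q Hp) as [delta Hd].
          assert (Hs : 0 < s + 1) by (unfold s; lra).
          exists (mkposreal _ (Rdiv_lt_0_compat _ _ (cond_pos delta) Hs)); simpl.
          intros a' c' t Ht Ha Hc HX.
          replace (t * s) with (a' + t * (b - a) - a' + (c' + t * (d - c) - c'))
            by (unfold s; ring).
          apply Hd; auto.
          replace (a' + t * (b - a) - a' + (c' + t * (d - c) - c')) with (t * s)
            by (unfold s; ring).
          destruct Ht as [Ht0 Ht].
          apply Rmult_lt_compat_r with (r := s + 1) in Ht; [|exact Hs].
          unfold Rdiv in Ht. rewrite Rmult_assoc, Rinv_l, Rmult_1_r in Ht by lra. lra.
        + exists (mkposreal 1 Rlt_0_1). intros. lra. }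
    unfold P in HP. rewrite !Rmult_1_l in HP.
    replace (a + (b - a)) with b in HP by ring.
    replace (c + (d - c)) with d in HP by ring. auto. }
  apply Rabs_eq_0, Rle_antisym; [|apply Rabs_pos].
  apply le_epsilon; intros e He. rewrite Rplus_0_l.
  assert (Hs : 0 < 2 * s ^ 2 + 1) by (pose proof (pow2_ge_0 s); lra).
  eapply Rle_trans; [apply (Hall (mkposreal _ (Rdiv_lt_0_compat _ _ He Hs)))|]. cbv [pos].
  replace (2 * (e / (2 * s ^ 2 + 1)) * s ^ 2) with (e * (2 * s ^ 2 / (2 * s ^ 2 + 1))) by (field; lra).
  apply Rle_trans with (e * 1); [apply Rmult_le_compat_l; [lra|] | lra].
  apply Rmult_le_reg_r with (2 * s ^ 2 + 1); [exact Hs|].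
  unfold Rdiv. rewrite Rmult_assoc, Rinv_l by lra. lra.
Qed.

End Goursat.

(** * Circular means *)

Lemma Cmod_le_Re_Im (c : C) : Cmod c <= Rabs (Re c) + Rabs (Im c).
Proof.
  replace c with (RtoC (Re c) + Ci * RtoC (Im c))%C at 1
    by (destruct c; unfold Cplus, Cmult, Ci, RtoC; simpl; f_equal; ring).
  eapply Rle_trans; [apply Cmod_triangle|].
  rewrite Cmod_mult, Cmod_Ci, !Cmod_R. lra.
Qed.

Lemma im_le_Cmod (c : C) : Rabs (Im c) <= Cmod c.
Proof. eapply Rle_trans; [apply Rmax_r | apply (Rmax_Cmod c)]. Qed.

Definition C_exp (s t : R) : C := (exp s * cos t, exp s * sin t).

Lemma C_exp_shift (p q s t : R) : C_exp s t = (C_exp p q * C_exp (s - p) (t - q))%C.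
Proof.
  unfold C_exp, Cmult; simpl.
  replace s with (p + (s - p)) at 1 2 by ring. rewrite exp_plus.
  replace t with (q + (t - q)) at 1 2 by ring. rewrite cos_plus, sin_plus.
  f_equal; ring.
Qed.

Lemma Cmod_C_exp (s t : R) : Cmod (C_exp s t) = exp s.
Proof.
  pose proof (exp_pos s).
  unfold Cmod, C_exp; simpl fst; simpl snd.
  replace ((exp s * cos t) ^ 2 + (exp s * sin t) ^ 2) with (exp s ^ 2).
  - apply sqrt_pow2; lra.
  - pose proof (sin2_cos2 t) as H1. unfold Rsqr in H1.
    replace ((exp s * cos t) ^ 2 + (exp s * sin t) ^ 2)
      with (exp s ^ 2 * (sin t * sin t + cos t * cos t)) by ring.
    rewrite H1; ring.
Qed.

Lemma derivable_pt_lim_approx (f : R -> R) (x l : R) :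
  derivable_pt_lim f x l -> forall eta : posreal, exists delta : posreal, forall h,
    Rabs h < delta -> Rabs (f (x + h) - f x - l * h) <= eta * Rabs h.
Proof.
  intros H eta. destruct (H eta (cond_pos eta)) as [d Hd]. exists d; intros h Hh.
  destruct (Req_dec h 0) as [-> | H0].
  - replace (f (x + 0) - f x - l * 0) with 0 by (rewrite Rplus_0_r; ring).
    rewrite Rabs_R0; lra.
  - replace (f (x + h) - f x - l * h) with (((f (x + h) - f x) / h - l) * h) by (field; auto).
    rewrite Rabs_mult. apply Rmult_le_compat_r; [apply Rabs_pos|].
    now apply Rlt_le, Hd.
Qed.

Lemma C_exp_approx_0 (eta : posreal) : exists delta : posreal, forall s t : R,
  Rabs s < delta -> Rabs t < delta ->
  Cmod (C_exp s t - 1 - (s, t))%C <= eta * (Rabs s + Rabs t).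
Proof.
  assert (He : 0 < Rmin (eta / 4) 1) by (apply Rmin_case; [pose proof (cond_pos eta); lra | lra]).
  set (e := mkposreal _ He).
  assert (He1 : e <= eta / 4) by apply Rmin_l.
  assert (He2 : e <= 1) by apply Rmin_r.
  destruct (derivable_pt_lim_approx exp 0 1) with (eta := e) as [d1 H1].
  { pose proof (derivable_pt_lim_exp 0) as H. now rewrite exp_0 in H. }
  destruct (derivable_pt_lim_approx cos 0 0) with (eta := e) as [d2 H2].
  { pose proof (derivable_pt_lim_cos 0) as H. now rewrite sin_0, Ropp_0 in H. }
  destruct (derivable_pt_lim_approx sin 0 1) with (eta := e) as [d3 H3].
  { pose proof (derivable_pt_lim_sin 0) as H. now rewrite cos_0 in H. }
  (* The bound e / 2 turns the mixed term 2 |s| |t| of the imaginary part into at most e |s|. *)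
  assert (Hd : 0 < Rmin (Rmin d1 d2) (Rmin d3 (e / 2))).
  { repeat apply Rmin_case; try apply cond_pos. simpl; lra. }
  exists (mkposreal _ Hd); intros s t Hs Ht; simpl pos in Hs, Ht.
  assert (Hmin : forall x, x < Rmin (Rmin d1 d2) (Rmin d3 (e / 2)) ->
    x < d1 /\ x < d2 /\ x < d3 /\ x < e / 2).
  { intros x Hx. apply Rmin_Rgt_l in Hx as [Ha Hb].
    apply Rmin_Rgt_l in Ha. apply Rmin_Rgt_l in Hb. tauto. }
  apply Hmin in Hs. apply Hmin in Ht.
  specialize (H1 s ltac:(tauto)). specialize (H2 t ltac:(tauto)). specialize (H3 t ltac:(tauto)).
  rewrite Rplus_0_l, ?exp_0, ?cos_0, ?sin_0 in *.
  assert (He0 : 0 < e) by apply cond_pos.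
  clearbody e. clear Hmin.
  destruct Hs as (_ & _ & _ & Hs). destruct Ht as (_ & _ & _ & Ht).
  assert (Has := Rabs_pos s). assert (Hat := Rabs_pos t).
  assert (Hr : Rabs (exp s * cos t - 1 - s) <= eta / 2 * (Rabs s + Rabs t)).
  { replace (exp s * cos t - 1 - s) with
      ((exp s - 1 - 1 * s) * cos t + (1 + s) * (cos t - 1 - 0 * t)) by ring.
    eapply Rle_trans; [apply Rabs_triang|]. rewrite !Rabs_mult.
    assert (Rabs (cos t) <= 1) by (apply Rabs_le, COS_bound).
    assert (Rabs (1 + s) <= 2)
      by (eapply Rle_trans; [apply Rabs_triang|]; rewrite Rabs_R1; lra).
    assert (Rabs (exp s - 1 - 1 * s) * Rabs (cos t) <= (e * Rabs s) * 1)
      by (apply Rmult_le_compat; auto using Rabs_pos).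
    assert (Rabs (1 + s) * Rabs (cos t - 1 - 0 * t) <= 2 * (e * Rabs t))
      by (apply Rmult_le_compat; auto using Rabs_pos).
    nra. }
  assert (Hi : Rabs (exp s * sin t - t) <= eta / 2 * (Rabs s + Rabs t)).
  { replace (exp s * sin t - t) with
      (exp s * (sin t - 0 - 1 * t) + (exp s - 1) * t) by ring.
    eapply Rle_trans; [apply Rabs_triang|]. rewrite !Rabs_mult.
    assert (Hs1 : Rabs (exp s - 1) <= 2 * Rabs s).
    { replace (exp s - 1) with ((exp s - 1 - 1 * s) + s) by ring.
      eapply Rle_trans; [apply Rabs_triang|]. nra. }
    assert (Hs2 : Rabs (exp s) <= 2).
    { replace (exp s) with ((exp s - 1) + 1) by ring.
      eapply Rle_trans; [apply Rabs_triang|]. rewrite Rabs_R1. lra. }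
    assert (Rabs (exp s) * Rabs (sin t - 0 - 1 * t) <= 2 * (e * Rabs t))
      by (apply Rmult_le_compat; auto using Rabs_pos).
    assert (Rabs (exp s - 1) * Rabs t <= 2 * Rabs s * Rabs t)
      by (apply Rmult_le_compat_r; auto).
    nra. }
  eapply Rle_trans; [apply Cmod_le_Re_Im|].
  unfold C_exp, Re, Im, Cminus, Cplus, Copp, RtoC; simpl.
  replace (exp s * cos t + - (1) + - s) with (exp s * cos t - 1 - s) by ring.
  replace (exp s * sin t + -0 + - t) with (exp s * sin t - t) by ring.
  lra.
Qed.

Lemma CR_differentiable_comp_C_exp (F : C -> C) (p q : R) :
  p < 0 -> C_ex_derive F (C_exp p q) ->
  CR_differentiable (fun x y => Re (F (C_exp x y))) (fun x y => Im (F (C_exp x y))) p q.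
Proof.
  intros Hp HF. set (w := C_exp p q) in *.
  apply ex_derive_C_epsilon in HF as [l Hl].
  assert (Hw : Cmod w <= 1).
  { unfold w. rewrite Cmod_C_exp, <- exp_0. left; now apply exp_increasing. }
  exists (Re (l * w)%C), (Im (l * w)%C); intros eta.
  assert (Heta := cond_pos eta). assert (Hml := Cmod_ge_0 l). assert (Hmw := Cmod_ge_0 w).
  (* In log coordinates the derivative is l w. Half of eta pays for the remainder of the exponential
     multiplied by l w, where |w| <= 1. The other half pays for the remainder of F: its rate eta / 4
     meets |[C_exp x y] - w| <= 2 N, which also explains d2 / 4 below. *)
  assert (H1 : 0 < Rmin 1 (eta / (2 * (Cmod l + 1))))
    by (apply Rmin_case; [lra | apply Rdiv_lt_0_compat; lra]).
  destruct (C_exp_approx_0 (mkposreal _ H1)) as [d1 Hd1]; simpl pos in Hd1.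
  set (e1 := Rmin 1 (eta / (2 * (Cmod l + 1)))) in *.
  assert (He1 : e1 <= 1) by apply Rmin_l.
  assert (He2 : e1 * (Cmod l + 1) <= eta / 2).
  { replace (eta / 2) with (eta / (2 * (Cmod l + 1)) * (Cmod l + 1)) by (field; lra).
    apply Rmult_le_compat_r; [lra | apply Rmin_r]. }
  assert (H2 : 0 < eta / 4) by lra.
  destruct (Hl (mkposreal _ H2)) as [d2 Hd2]; simpl pos in Hd2.
  assert (Hd : 0 < Rmin d1 (d2 / 4))
    by (apply Rmin_case; [apply cond_pos | pose proof (cond_pos d2); lra]).
  exists (mkposreal _ Hd); intros x y Hx Hy; simpl pos in Hx, Hy.
  apply Rmin_Rgt_l in Hx as [Hx1 Hx2]. apply Rmin_Rgt_l in Hy as [Hy1 Hy2].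
  specialize (Hd1 _ _ Hx1 Hy1).
  set (N := Rabs (x - p) + Rabs (y - q)) in *.
  assert (HN : 0 <= N) by (unfold N; pose proof (Rabs_pos (x - p)); pose proof (Rabs_pos (y - q)); lra).
  set (zeta := (x - p, y - q) : C) in *.
  assert (Hz : Cmod zeta <= N) by apply (Cmod_le_Re_Im zeta).
  set (rho := (C_exp (x - p) (y - q) - 1 - zeta)%C) in *.
  assert (HE : C_exp x y = (w * (1 + zeta + rho))%C).
  { rewrite (C_exp_shift p q x y). fold w. f_equal. unfold rho. ring. }
  assert (HEw : Cmod (C_exp x y - w)%C <= 2 * N).
  { replace (C_exp x y - w)%C with (w * (zeta + rho))%C by (rewrite HE; ring).
    rewrite Cmod_mult. pose proof (Cmod_triangle zeta rho). pose proof (Cmod_ge_0 (zeta + rho)).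
    nra. }
  specialize (Hd2 (C_exp x y) ltac:(unfold N in *; lra)).
  assert (Hmain : Cmod (F (C_exp x y) - F w - l * w * zeta)%C <= eta * N).
  { replace (F (C_exp x y) - F w - l * w * zeta)%C
      with ((F (C_exp x y) - F w - l * (C_exp x y - w)) + l * (w * rho))%C
      by (rewrite HE; ring).
    eapply Rle_trans; [apply Cmod_triangle|]. rewrite !Cmod_mult.
    assert (Hr0 := Cmod_ge_0 rho).
    assert (Cmod l * (Cmod w * Cmod rho) <= Cmod l * (1 * (e1 * N)))
      by (apply Rmult_le_compat_l; [exact Hml|]; apply Rmult_le_compat; auto).
    nra. }
  change (F (C_exp p q)) with (F w). generalize dependent (F (C_exp x y)); intros f _ Hmain.
  set (lw := (l * w)%C) in *. clearbody lw.
  split; (eapply Rle_trans; [|exact Hmain]).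
  - replace (Re f - Re (F w) - (Re lw * (x - p) - Im lw * (y - q)))
      with (Re (f - F w - lw * zeta)%C) by reflexivity.
    apply re_le_Cmod.
  - replace (Im f - Im (F w) - (Im lw * (x - p) + Re lw * (y - q)))
      with (Im (f - F w - lw * zeta)%C)
      by (unfold zeta, Re, Im, Cminus, Cplus, Copp, Cmult; simpl; ring).
    apply im_le_Cmod.
Qed.

(* In the coordinates [z = exp (s + i t)] the left and right sides of
   [s0 <= s <= s1, 0 <= t <= 2 pi] carry the means over two circles, and the
   other two sides cancel by periodicity. *)
Lemma circular_mean_constant (F : C -> C) (a b : R) :
  (forall z, unit_disk z -> C_ex_derive F z) -> a <= b -> b < 0 ->
  RInt (fun t => Im (F (C_exp a t))) 0 (2 * PI) =
  RInt (fun t => Im (F (C_exp b t))) 0 (2 * PI).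
Proof.
  intros HF Hab Hb. pose proof PI_RGT_0.
  pose proof (Goursat_rectangle (fun x y => Re (F (C_exp x y))) (fun x y => Im (F (C_exp x y))) 0)
    as HG.
  specialize (HG ltac:(intros p q Hp; apply CR_differentiable_comp_C_exp;
    [exact Hp | apply HF; unfold unit_disk; rewrite Cmod_C_exp, <- exp_0; now apply exp_increasing])).
  specialize (HG a b 0 (2 * PI) Hab Hb ltac:(lra)).
  unfold circulation, vertical in HG.
  replace (horizontal (fun x y => Re (F (C_exp x y))) (2 * PI) a b)
    with (horizontal (fun x y => Re (F (C_exp x y))) 0 a b) in HG; [lra|].
  unfold horizontal. apply RInt_ext; intros x _. unfold C_exp.
  now rewrite cos_0, sin_0, cos_2PI, sin_2PI.
Qed.

(** In log coordinates the centre lies at minus infinity, so it is approached through a tiny circle: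
    there the mean is within e of the value at 0 by continuity, and it equals the mean over the
    circle of radius r. *)
Lemma Cmod_center_le (F : C -> C) (r M : R) :
  0 < r < 1 -> (forall z, unit_disk z -> C_ex_derive F z) ->
  (forall z, Cmod z = r -> Cmod (F z) <= M) -> Cmod (F 0) <= M.
Proof.
  intros Hr HF HM.
  destruct (Ceq_dec (F 0) 0) as [H0 | H0].
  { rewrite H0, Cmod_0. eapply Rle_trans; [apply Cmod_ge_0|].
    apply (HM (RtoC r)). rewrite Cmod_R. apply Rabs_pos_eq; lra. }
  set (m := Cmod (F 0)) in *.
  assert (Hm : 0 < m) by now apply Cmod_gt_0.
  (* Rotated so that the imaginary part at 0 is the modulus. *)
  set (kappa := (Ci * Cconj (F 0) / RtoC m)%C).
  assert (Hmc : RtoC m <> 0) by (intros H; apply RtoC_inj in H; lra).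
  assert (Hk : Cmod kappa = 1).
  { unfold kappa. rewrite Cmod_div, Cmod_mult, Cmod_Ci, Cmod_conj, Cmod_R by exact Hmc.
    rewrite Rabs_pos_eq by lra. fold m. field. lra. }
  assert (Hk0 : (kappa * F 0)%C = (Ci * RtoC m)%C).
  { unfold kappa.
    replace (Ci * Cconj (F 0) / RtoC m * F 0)%C with (Ci * (F 0 * Cconj (F 0)) / RtoC m)%C
      by (field; exact Hmc).
    rewrite <- Cmod2_conj. fold m.
    replace (m ^ 2) with (m * m) by ring. rewrite RtoC_mult. field; exact Hmc. }
  set (G := fun z => (kappa * F z)%C).
  assert (HG : forall z, unit_disk z -> C_ex_derive G z)
    by (intros z Hz; apply C_ex_derive_mult; [apply C_ex_derive_const | now apply HF]).
  assert (HGm : forall z, Cmod (G z) = Cmod (F z))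
    by (intros z; unfold G; rewrite Cmod_mult, Hk; ring).
  assert (HG0 : Im (G 0) = m) by (unfold G; rewrite Hk0; unfold Im, Cmult, Ci, RtoC; simpl; ring).
  apply le_epsilon; intros e He.
  assert (H00 : unit_disk 0) by (unfold unit_disk; rewrite Cmod_0; lra).
  destruct (C_ex_derive_continuous G 0 (HG _ H00) (mkposreal e He)) as [d Hd]; simpl pos in Hd.
  (* The circle of radius exp a is no larger than that of radius r and lies where G is within e of G
     0. *)
  set (b := ln r). set (a := Rmin b (ln (d / 2))).
  assert (Hd0 := cond_pos d).
  assert (Hb : exp b = r) by (apply exp_ln; lra).
  assert (Hb0 : b < 0) by (rewrite <- ln_1; apply ln_increasing; lra).
  assert (Hab : a <= b) by apply Rmin_l.
  assert (Had : exp a < d).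
  { rewrite <- (exp_ln d) by exact Hd0. apply exp_increasing.
    apply Rle_lt_trans with (1 := Rmin_r _ _). apply ln_increasing; lra. }
  pose proof PI_RGT_0 as HPI.
  pose proof (circular_mean_constant G a b HG Hab Hb0) as Hmean.
  assert (Hex : forall s, s < 0 -> ex_RInt (fun t => Im (G (C_exp s t))) 0 (2 * PI)).
  { intros s Hs. apply (ex_vertical (fun x y => Re (G (C_exp x y))) (fun x y => Im (G (C_exp x y))) 0); auto.
    intros p q Hp. apply CR_differentiable_comp_C_exp; [exact Hp|].
    apply HG. unfold unit_disk. rewrite Cmod_C_exp, <- exp_0. now apply exp_increasing. }
  assert (H1 : (2 * PI) * (m - e) <= RInt (fun t => Im (G (C_exp a t))) 0 (2 * PI)).
  { replace ((2 * PI) * (m - e)) with (RInt (fun _ => m - e) 0 (2 * PI))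
      by (rewrite RInt_const; unfold scal; simpl; unfold mult; simpl; ring).
    apply RInt_le; [lra | apply ex_RInt_const | apply Hex; lra |].
    intros t _.
    assert (Hc : Cmod (G (C_exp a t) - G 0)%C < e).
    { apply Hd. replace (C_exp a t - 0)%C with (C_exp a t) by ring. now rewrite Cmod_C_exp. }
    pose proof (im_le_Cmod (G (C_exp a t) - G 0)%C) as Hi.
    replace (Im (G (C_exp a t) - G 0)%C) with (Im (G (C_exp a t)) - Im (G 0)) in Hi by reflexivity.
    rewrite HG0 in Hi. apply Rabs_le_between in Hi. lra. }
  assert (H2 : RInt (fun t => Im (G (C_exp b t))) 0 (2 * PI) <= (2 * PI) * M).
  { replace ((2 * PI) * M) with (RInt (fun _ => M) 0 (2 * PI))
      by (rewrite RInt_const; unfold scal; simpl; unfold mult; simpl; ring).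
    apply RInt_le; [lra | apply Hex; lra | apply ex_RInt_const |].
    intros t _. eapply Rle_trans; [apply Rle_abs|].
    eapply Rle_trans; [apply im_le_Cmod|]. rewrite HGm. apply HM.
    now rewrite Cmod_C_exp. }
  assert (m - e <= M); [|lra].
  apply Rmult_le_reg_l with (2 * PI); lra.
Qed.

(** * Moebius maps and the Schwarz-Pick lemma *)

(** Both squares have the same cross term 2 Re (conj s r e). This identity yields the contraction
    property of [T] as well as the position of the image disk. *)
Lemma Moebius_modulus (r s e : C) :
  Cmod (s + r * e)%C ^ 2 - Cmod (Cconj s * e + Cconj r)%C ^ 2 =
  (Cmod s ^ 2 - Cmod r ^ 2) * (1 - Cmod e ^ 2).
Proof.
  rewrite !Cmod2_alt. destruct r, s, e.
  unfold Re, Im, Cplus, Cmult, Cconj; simpl. ring.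
Qed.

Lemma Cmod_lower (a z : C) : Cmod z <= 1 -> 1 - Cmod a <= Cmod (1 + Cconj a * z)%C.
Proof.
  intros Hz. pose proof (Cmod_triangle (1 + Cconj a * z) (- (Cconj a * z)))%C as H.
  replace (1 + Cconj a * z + - (Cconj a * z))%C with (RtoC 1) in H by ring.
  rewrite Cmod_opp, Cmod_mult, Cmod_conj, Cmod_1 in H.
  pose proof (Cmod_ge_0 a). nra.
Qed.

Lemma T_denominator_neq_0 (a z : C) :
  Cmod a < 1 -> Cmod z <= 1 -> (1 + Cconj a * z)%C <> 0.
Proof.
  intros Ha Hz. apply Cmod_gt_0. pose proof (Cmod_lower a z Hz). lra.
Qed.

Lemma T_modulus (a z : C) : Cmod a < 1 -> Cmod z <= 1 ->
  Cmod (1 + Cconj a * z)%C ^ 2 * (1 - Cmod (T a z) ^ 2) =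
  (1 - Cmod a ^ 2) * (1 - Cmod z ^ 2).
Proof.
  intros Ha Hz. assert (H0 := T_denominator_neq_0 a z Ha Hz).
  pose proof (Moebius_modulus (Cconj a) 1 z) as H.
  rewrite Cmod_1, Cmod_conj, Cconj_conj in H.
  replace (Cconj 1) with (RtoC 1) in H by (unfold Cconj, RtoC; simpl; f_equal; ring).
  rewrite Cmult_1_l in H. unfold T. rewrite Cmod_div by exact H0.
  apply Cmod_gt_0 in H0.
  replace ((1 - Cmod a ^ 2) * (1 - Cmod z ^ 2)) with
    ((1 ^ 2 - Cmod a ^ 2) * (1 - Cmod z ^ 2)) by ring.
  rewrite <- H. field. lra.
Qed.

Lemma Cmod_lt_1_pow2 (z : C) : Cmod z < 1 <-> 0 < 1 - Cmod z ^ 2.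
Proof. pose proof (Cmod_ge_0 z). split; intros; nra. Qed.

Lemma Cmod_le_1_pow2 (z : C) : Cmod z <= 1 <-> 0 <= 1 - Cmod z ^ 2.
Proof. pose proof (Cmod_ge_0 z). split; intros; nra. Qed.

Lemma T_closed (a z : C) : Cmod a < 1 -> Cmod z <= 1 -> Cmod (T a z) <= 1.
Proof.
  intros Ha Hz. pose proof (T_modulus a z Ha Hz) as H.
  pose proof (T_denominator_neq_0 a z Ha Hz) as H0. apply Cmod_gt_0 in H0.
  apply Cmod_lt_1_pow2 in Ha. apply Cmod_le_1_pow2 in Hz. apply Cmod_le_1_pow2.
  apply Rmult_le_reg_l with (Cmod (1 + Cconj a * z)%C ^ 2); [nra|].
  rewrite H, Rmult_0_r. apply Rmult_le_pos; lra.
Qed.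

Lemma T_open (a z : C) : Cmod a < 1 -> Cmod z < 1 -> Cmod (T a z) < 1.
Proof.
  intros Ha Hz. pose proof (T_modulus a z Ha (Rlt_le _ _ Hz)) as H.
  pose proof (T_denominator_neq_0 a z Ha (Rlt_le _ _ Hz)) as H0. apply Cmod_gt_0 in H0.
  apply Cmod_lt_1_pow2 in Ha. apply Cmod_lt_1_pow2 in Hz. apply Cmod_lt_1_pow2.
  apply Rmult_lt_reg_l with (Cmod (1 + Cconj a * z)%C ^ 2); [nra|].
  rewrite H, Rmult_0_r. apply Rmult_lt_0_compat; lra.
Qed.

Lemma T_opp_r (a z : C) : Cmod a < 1 -> Cmod z <= 1 -> T a (T (- a) z) = z.
Proof.
  intros Ha Hz.
  assert (Ha' : Cmod (- a)%C < 1) by now rewrite Cmod_opp.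
  assert (H1 := T_denominator_neq_0 _ z Ha' Hz).
  assert (H2 := T_denominator_neq_0 _ _ Ha (T_closed _ z Ha' Hz)).
  unfold T in *. rewrite Copp_conj in *.
  assert (H3 : ((1 + - Cconj a * z) + Cconj a * (z + - a))%C <> 0).
  { intros H; apply H2.
    transitivity (((1 + - Cconj a * z) + Cconj a * (z + - a)) / (1 + - Cconj a * z))%C;
      [field; exact H1 | rewrite H; field; exact H1]. }
  field. split; [exact H1 | intros H; apply H3; rewrite <- H; ring].
Qed.

Lemma T_0 (a : C) : T a 0 = a.
Proof. unfold T. field. Qed.

Lemma T_opp_self (a : C) : T (- a) a = 0.
Proof. unfold T, Cdiv. rewrite Cplus_opp_r. ring. Qed.

Lemma T_opp_neq_0 (a z : C) : Cmod a < 1 -> Cmod z <= 1 -> z <> a -> T (- a) z <> 0.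
Proof.
  intros Ha Hz Hza H. apply Hza.
  rewrite <- (T_opp_r a z Ha Hz), H. apply T_0.
Qed.

Lemma C_ex_derive_T (a z : C) : Cmod a < 1 -> Cmod z <= 1 -> C_ex_derive (T a) z.
Proof.
  intros Ha Hz. apply C_ex_derive_div.
  - apply C_ex_derive_plus; [apply C_ex_derive_id | apply C_ex_derive_const].
  - apply C_ex_derive_plus; [apply C_ex_derive_const|].
    apply C_ex_derive_mult; [apply C_ex_derive_const | apply C_ex_derive_id].
  - now apply T_denominator_neq_0.
Qed.

(** Automorphisms of the disk are proper: by [T_modulus], 1 - |T_a(z)|^2 tends to 0 uniformly as |z|
    tends to 1. *)
Lemma T_boundary (a : C) (r : R) : Cmod a < 1 -> r < 1 ->
  exists rho, 0 < rho < 1 /\ forall z, rho <= Cmod z < 1 -> r < Cmod (T a z).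
Proof.
  intros Ha Hr. set (k := 1 - Cmod a).
  assert (Hk : 0 < k) by (unfold k; lra).
  assert (Ha0 := Cmod_ge_0 a).
  destruct (Rlt_le_dec r 0) as [Hr0 | Hr0].
  { exists (1 / 2); split; [lra|]. intros z _. pose proof (Cmod_ge_0 (T a z)). lra. }
  assert (Hk2 : 0 < k ^ 2 * (1 - r ^ 2)) by (apply Rmult_lt_0_compat; nra).
  (* For |z| >= 1 - m one has 1 - |z|^2 <= 2 m <= k^2 (1 - r^2) / 2, while |T_a(z)| <= r would force
     it to be at least k^2 (1 - r^2), as k bounds the denominator of T_a from below. *)
  set (m := Rmin (1 / 2) (k ^ 2 * (1 - r ^ 2) / 4)).
  assert (Hm1 : m <= 1 / 2) by apply Rmin_l.
  assert (Hm2 : m <= k ^ 2 * (1 - r ^ 2) / 4) by apply Rmin_r.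
  assert (Hm0 : 0 < m) by (apply Rmin_case; lra).
  exists (1 - m); split; [lra|]. intros z Hz.
  assert (Hz1 : Cmod z <= 1) by lra.
  pose proof (T_modulus a z Ha Hz1) as H.
  pose proof (Cmod_lower a z Hz1) as Hl. fold k in Hl.
  pose proof (Cmod_ge_0 (T a z)).
  assert (H2 : k ^ 2 <= Cmod (1 + Cconj a * z)%C ^ 2) by (apply pow_incr; lra).
  apply Rnot_le_lt; intros Hle.
  assert (H3 : 1 - r ^ 2 <= 1 - Cmod (T a z) ^ 2) by nra.
  assert (H4 : k ^ 2 * (1 - r ^ 2) <= Cmod (1 + Cconj a * z)%C ^ 2 * (1 - Cmod (T a z) ^ 2))
    by (apply Rmult_le_compat; nra).
  assert (H5 : (1 - Cmod a ^ 2) * (1 - Cmod z ^ 2) <= 1 * (2 * m))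
    by (apply Rmult_le_compat; nra).
  lra.
Qed.

Lemma C_ex_derive_Lipschitz (f : C -> C) (z : C) : C_ex_derive f z ->
  exists (K : R) (delta : posreal), 0 <= K /\
    forall y, Cmod (y - z)%C < delta -> Cmod (f y - f z)%C <= K * Cmod (y - z)%C.
Proof.
  intros H. apply ex_derive_C_epsilon in H as [l H].
  destruct (H (mkposreal 1 Rlt_0_1)) as [d Hd]. simpl pos in Hd.
  exists (1 + Cmod l), d. split; [pose proof (Cmod_ge_0 l); lra|].
  intros y Hy. specialize (Hd y Hy).
  replace (f y - f z)%C with ((f y - f z - l * (y - z)) + l * (y - z))%C by ring.
  eapply Rle_trans; [apply Cmod_triangle|]. rewrite Cmod_mult. lra.
Qed.

(** * Maximum principle and Schwarz-Pick lemma off a finite set *)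

Definition vanishing (L : list C) (z : C) : C :=
  fold_right (fun e p => (z - e) * p)%C (RtoC 1) L.

Lemma vanishing_eq_0 (L : list C) (z : C) : vanishing L z = 0 <-> In z L.
Proof.
  induction L as [|e L IH]; simpl.
  - split; [intros H; apply RtoC_inj in H; lra | tauto].
  - rewrite <- IH; clear IH. split.
    + intros H. destruct (Ceq_dec z e) as [-> | Hze]; [now left|].
      destruct (Ceq_dec (vanishing L z) 0) as [H0 | H0]; [now right|].
      exfalso. revert H. apply Cmult_neq_0; [|exact H0].
      intros H. apply Hze. replace z with ((z - e) + e)%C by ring. rewrite H. ring.
    + intros [-> | ->]; ring.
Qed.

Lemma C_ex_derive_vanishing (L : list C) (z : C) : C_ex_derive (vanishing L) z.
Proof.
  induction L as [|e L IH].
  - apply C_ex_derive_const.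
  - apply (C_ex_derive_mult (fun z => z - e)%C (vanishing L)); [|exact IH].
    apply C_ex_derive_minus; [apply C_ex_derive_id | apply C_ex_derive_const].
Qed.

Lemma vanishing_bounded (L : list C) :
  exists K, forall z, unit_disk z -> Cmod (vanishing L z) <= K.
Proof.
  induction L as [|e L [K HK]].
  - exists 1; intros z _. simpl. rewrite Cmod_1; lra.
  - exists ((1 + Cmod e) * K); intros z Hz. simpl. rewrite Cmod_mult.
    apply Rmult_le_compat; try apply Cmod_ge_0; [|now apply HK].
    eapply Rle_trans; [apply Cmod_triangle|]. rewrite Cmod_opp.
    unfold unit_disk in Hz. lra.
Qed.

(** At a point of [L] the Lipschitz bound for the polynomial gives at most (K q)^2 M'^N at distance
    q, so the derivative there is 0. At the other points of [L] met nearby the zero factor absorbs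
    the arbitrary value of g. *)
Lemma C_ex_derive_regularized (L : list C) (g : C -> C) (M : R) (N : nat) :
  (forall z, unit_disk z -> ~ In z L -> C_ex_derive g z /\ Cmod (g z) <= M) ->
  forall z, unit_disk z -> C_ex_derive (fun y => vanishing L y ^ 2 * g y ^ N)%C z.
Proof.
  intros Hg z Hz. destruct (classic (In z L)) as [HL | HL].
  2:{ apply C_ex_derive_mult; apply C_ex_derive_pow;
        [apply C_ex_derive_vanishing | now apply Hg]. }
  destruct (C_ex_derive_Lipschitz (vanishing L) z (C_ex_derive_vanishing L z))
    as [K [d [HK Hd]]].
  apply vanishing_eq_0 in HL. rewrite HL in Hd.
  apply ex_derive_C_epsilon. exists (RtoC 0). intros eta.
  assert (Heta := cond_pos eta). unfold unit_disk in Hz.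
  set (M' := Rmax M 0). assert (HM' : 0 <= M') by apply Rmax_r.
  assert (HQ : 0 < K ^ 2 * M' ^ N + 1)
    by (pose proof (pow2_ge_0 K); pose proof (pow_le M' N HM'); nra).
  assert (Hd0 : 0 < Rmin (Rmin d (1 - Cmod z)) (eta / (K ^ 2 * M' ^ N + 1))).
  { apply Rmin_case; [apply Rmin_case; [apply cond_pos | lra]|].
    now apply Rdiv_lt_0_compat. }
  exists (mkposreal _ Hd0); intros y Hy; simpl pos in Hy.
  apply Rmin_Rgt_l in Hy as [Hy Hy3]. apply Rmin_Rgt_l in Hy as [Hy1 Hy2].
  assert (Hyd : unit_disk y).
  { unfold unit_disk. replace y with (z + (y - z))%C by ring.
    pose proof (Cmod_triangle z (y - z)%C). lra. }
  replace (vanishing L y ^ 2 * g y ^ N - vanishing L z ^ 2 * g z ^ N - 0 * (y - z))%C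
    with (vanishing L y ^ 2 * g y ^ N)%C by (rewrite HL; ring).
  set (q := Cmod (y - z)%C) in *. assert (Hq : 0 <= q) by apply Cmod_ge_0.
  destruct (classic (In y L)) as [HyL | HyL].
  { apply vanishing_eq_0 in HyL. rewrite HyL.
    replace (0 ^ 2 * g y ^ N)%C with (RtoC 0) by ring. rewrite Cmod_0.
    apply Rmult_le_pos; lra. }
  rewrite Cmod_mult, !Cmod_pow.
  specialize (Hd y Hy1). replace (vanishing L y - 0)%C with (vanishing L y) in Hd by ring.
  fold q in Hd.
  assert (H1 : Cmod (vanishing L y) ^ 2 <= (K * q) ^ 2)
    by (apply pow_incr; split; [apply Cmod_ge_0 | exact Hd]).
  assert (H2 : Cmod (g y) ^ N <= M' ^ N).
  { apply pow_incr; split; [apply Cmod_ge_0|].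
    apply Rle_trans with M; [now apply Hg | apply Rmax_l]. }
  apply Rle_trans with ((K * q) ^ 2 * M' ^ N).
  { apply Rmult_le_compat; auto using pow_le, Cmod_ge_0. }
  replace ((K * q) ^ 2 * M' ^ N) with (K ^ 2 * M' ^ N * q * q) by ring.
  apply Rmult_le_compat_r; [exact Hq|].
  apply Rle_trans with ((K ^ 2 * M' ^ N + 1) * q); [nra|].
  apply Rlt_le in Hy3.
  apply Rmult_le_compat_l with (r := K ^ 2 * M' ^ N + 1) in Hy3; [|lra].
  replace (pos eta) with ((K ^ 2 * M' ^ N + 1) * (eta / (K ^ 2 * M' ^ N + 1))) by (field; lra).
  exact Hy3.
Qed.

Lemma pow_domination (a c x y : R) : 0 < a -> 0 < y ->
  (forall N : nat, a * x ^ N <= c * y ^ N) -> x <= y.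
Proof.
  intros Ha Hy H. apply Rnot_lt_le; intros Hxy.
  assert (Hq : 1 < x / y).
  { apply Rmult_lt_reg_r with y; [exact Hy|]. unfold Rdiv.
    rewrite Rmult_assoc, Rinv_l by lra. lra. }
  destruct (Pow_x_infinity (x / y) ltac:(rewrite Rabs_pos_eq; lra) (c / a + 1)) as [N HN].
  specialize (HN N (le_n N)). rewrite Rabs_pos_eq in HN by (apply pow_le; lra).
  specialize (H N).
  assert (Hyn : 0 < y ^ N) by (now apply pow_lt).
  unfold Rdiv in HN. rewrite Rpow_mult_distr, pow_inv in HN.
  assert (Hc : c / a + 1 <= c / a); [|lra].
  apply Rle_trans with (x ^ N * / y ^ N); [unfold Rdiv; lra|].
  apply Rmult_le_reg_r with (a * y ^ N); [nra|].
  replace (x ^ N * / y ^ N * (a * y ^ N)) with (a * x ^ N) by (field; lra).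
  replace (c / a * (a * y ^ N)) with (c * y ^ N) by (field; lra). exact H.
Qed.

(* [p^2 g^N], with [p] vanishing on the exceptional set, is differentiable
   everywhere; letting [N] tend to infinity removes the effect of [p]. *)
Lemma maximum_principle (L : list C) (g : C -> C) (M : R) :
  (forall z, unit_disk z -> ~ In z L -> C_ex_derive g z /\ Cmod (g z) <= M) ->
  (forall eta : posreal, exists r, r < 1 /\
    forall z, unit_disk z -> ~ In z L -> r < Cmod z -> Cmod (g z) <= 1 + eta) ->
  forall z, unit_disk z -> ~ In z L -> Cmod (g z) <= 1.
Proof.
  intros Hg Hb z Hz HL. apply le_epsilon; intros e He.
  destruct (Hb (mkposreal e He)) as [r [Hr Hbr]]; simpl pos in Hbr.
  destruct (T_boundary z r Hz Hr) as [rho [Hrho HT]].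
  destruct (vanishing_bounded L) as [K HK].
  apply pow_domination with (a := Cmod (vanishing L z) ^ 2) (c := K ^ 2); [|lra|].
  - apply pow_lt, Cmod_gt_0. now rewrite vanishing_eq_0.
  - intros N. rewrite <- Cmod_pow, <- Cmod_pow, <- Cmod_mult.
    (* Writing z as T_z(0) makes z the centre, where [Cmod_center_le] applies to the composition
       with T_z. *)
    rewrite <- (T_0 z) at 1 2.
    apply (Cmod_center_le (fun y => vanishing L (T z y) ^ 2 * g (T z y) ^ N)%C rho).
    + exact Hrho.
    + intros y Hy.
      apply (C_ex_derive_comp (fun y => vanishing L y ^ 2 * g y ^ N)%C (T z)).
      * apply (C_ex_derive_regularized L g M N Hg). now apply T_open.
      * apply C_ex_derive_T; [exact Hz | now apply Rlt_le].
    + intros y Hy. assert (HTy : unit_disk (T z y)) by (apply T_open; [exact Hz | lra]).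
      assert (Hpos : 0 <= K ^ 2 * (1 + e) ^ N)
        by (apply Rmult_le_pos; [apply pow2_ge_0 | apply pow_le; lra]).
      destruct (classic (In (T z y) L)) as [HyL | HyL].
      * apply vanishing_eq_0 in HyL. rewrite HyL.
        replace (0 ^ 2 * g (T z y) ^ N)%C with (RtoC 0) by ring. now rewrite Cmod_0.
      * rewrite Cmod_mult, !Cmod_pow.
        apply Rmult_le_compat; try (apply pow_le, Cmod_ge_0);
          apply pow_incr; (split; [apply Cmod_ge_0|]).
        -- now apply HK.
        -- apply Hbr; auto. apply HT; lra.
Qed.

Definition punctured_Schur (L : list C) (f : C -> C) : Prop :=
  forall z, unit_disk z -> ~ In z L -> C_ex_derive f z /\ Cmod (f z) <= 1.

(** The quotient is bounded on the punctured disk, and near the unit circle its denominator has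
    modulus close to 1 while the numerator stays at most 1; the maximum principle does the rest. *)
Lemma Schwarz_Pick (L : list C) (f : C -> C) (a : C) :
  punctured_Schur L f -> unit_disk a -> ~ In a L -> unit_disk (f a) ->
  punctured_Schur (a :: L) (fun z => T (- f a) (f z) / T (- a) z)%C.
Proof.
  intros Hf Ha HaL Hb. unfold unit_disk in Ha, Hb.
  assert (Ha' : Cmod (- a)%C < 1) by now rewrite Cmod_opp.
  assert (Hb' : Cmod (- f a)%C < 1) by now rewrite Cmod_opp.
  set (h := fun z => T (- f a) (f z)).
  assert (Hh : punctured_Schur L h).
  { intros z Hz HzL. destruct (Hf z Hz HzL) as [H1 H2]. split; [|now apply T_closed].
    apply (C_ex_derive_comp (T (- f a)) f); [now apply C_ex_derive_T | exact H1]. }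
  assert (Hsplit : forall z, unit_disk z -> ~ In z (a :: L) ->
      ~ In z L /\ T (- a) z <> 0 /\ C_ex_derive (fun z => h z / T (- a) z)%C z).
  { intros z Hz HzL. unfold unit_disk in Hz.
    assert (HzL' : ~ In z L) by (intros H; apply HzL; now right).
    assert (H0 : T (- a) z <> 0)
      by (apply T_opp_neq_0; [exact Ha | lra | intros ->; apply HzL; now left]).
    split; [exact HzL'|]; split; [exact H0|].
    apply C_ex_derive_div; [now apply Hh | apply C_ex_derive_T; [exact Ha' | lra] | exact H0]. }
  destruct (C_ex_derive_Lipschitz h a) as [K [d [HK Hd]]]; [now apply Hh|].
  assert (Hd0 := cond_pos d).
  assert (Hha : h a = 0) by apply T_opp_self. rewrite Hha in Hd.
  intros z0 Hz0 Hz0L. split; [now apply Hsplit|]. revert z0 Hz0 Hz0L.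
  (* Since |z - a| <= 2 |T_(-a)(z)|, the Lipschitz bound gives 2 K within distance d of a, and
     elsewhere the denominator is at least d / 2, giving 2 / d. *)
  apply maximum_principle with (M := 2 * K + 2 / d).
  - intros z Hz HzL. destruct (Hsplit z Hz HzL) as [HzL' [H0 Hder]].
    split; [exact Hder|]. unfold unit_disk in Hz.
    rewrite Cmod_div by exact H0. apply Cmod_gt_0 in H0.
    assert (Hdist : Cmod (z - a)%C <= 2 * Cmod (T (- a) z)).
    { replace (z - a)%C with (T (- a) z * (1 + Cconj (- a) * z))%C.
      - rewrite Cmod_mult, Rmult_comm. apply Rmult_le_compat_r; [lra|].
        eapply Rle_trans; [apply Cmod_triangle|].
        rewrite Cmod_mult, Cmod_conj, Cmod_1.
        pose proof (Cmod_ge_0 (- a)%C). pose proof (Cmod_ge_0 z). nra.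
      - unfold T. field. apply T_denominator_neq_0; [exact Ha' | lra]. }
    assert (H2d : 0 < 2 / d) by (apply Rdiv_lt_0_compat; lra).
    apply Rle_div_l; [exact H0|]. change (T (- f a) (f z)) with (h z). rewrite Rmult_plus_distr_r.
    assert (0 <= K * Cmod (T (- a) z)) by (apply Rmult_le_pos; lra).
    assert (0 <= 2 / d * Cmod (T (- a) z)) by (apply Rmult_le_pos; lra).
    destruct (Rlt_le_dec (Cmod (z - a)%C) d) as [Hzd | Hzd].
    + specialize (Hd z Hzd). replace (h z - 0)%C with (h z) in Hd by ring.
      assert (K * Cmod (z - a)%C <= K * (2 * Cmod (T (- a) z)))
        by (apply Rmult_le_compat_l; assumption).
      lra.
    + assert (Hhz : Cmod (h z) <= 1) by now apply Hh.
      assert (H3 : 1 <= 2 / d * Cmod (T (- a) z)); [|lra].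
      replace 1 with (2 / d * (d / 2)) by (field; lra).
      apply Rmult_le_compat_l; lra.
  - intros eta. assert (Heta := cond_pos eta).
    assert (Hinv : 0 < / (1 + eta) < 1).
    { split; [apply Rinv_0_lt_compat; lra|].
      rewrite <- Rinv_1. apply Rinv_lt_contravar; lra. }
    destruct (T_boundary (- a) (/ (1 + eta)) Ha' (proj2 Hinv)) as [rho [Hrho HT]].
    exists rho; split; [lra|]. intros z Hz HzL Hrz.
    destruct (Hsplit z Hz HzL) as [HzL' [H0 _]].
    specialize (HT z ltac:(unfold unit_disk in Hz; lra)).
    rewrite Cmod_div by exact H0. apply Cmod_gt_0 in H0.
    apply Rmult_le_reg_r with (1 := H0). unfold Rdiv.
    rewrite Rmult_assoc, Rinv_l, Rmult_1_r by lra.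
    apply Rle_trans with 1; [now apply Hh|].
    replace 1 with ((1 + eta) * / (1 + eta)) at 1 by (field; lra).
    apply Rmult_le_compat_l; lra.
Qed.

(* The Schwarz-Pick inequality for [lambda g] at [x], in the limit
   [lambda -> 1], reads [|g y - g x| <= |T(-x)(y)| |g y - g x|]. *)
Lemma strong_maximum_principle (L : list C) (g : C -> C) (x : C) :
  punctured_Schur L g -> unit_disk x -> ~ In x L -> Cmod (g x) = 1 ->
  forall y, unit_disk y -> ~ In y L -> g y = g x.
Proof.
  intros Hg Hx HxL Hgx y Hy HyL.
  destruct (Ceq_dec y x) as [-> | Hyx]; [reflexivity|].
  unfold unit_disk in Hx, Hy.
  assert (Hx' : Cmod (- x)%C < 1) by now rewrite Cmod_opp.
  set (kappa := Cmod (T (- x) y)). set (d := Cmod (g y - g x)%C).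
  assert (Hk1 : kappa < 1) by now apply T_open.
  assert (HT0 : T (- x) y <> 0) by (apply T_opp_neq_0; [exact Hx | lra | exact Hyx]).
  assert (Hk0 : 0 < kappa) by now apply Cmod_gt_0.
  assert (Hgy : Cmod (g y) <= 1) by now apply Hg.
  assert (Hd0 : 0 <= d) by apply Cmod_ge_0.
  assert (Hd2 : d <= 2).
  { unfold d, Cminus. eapply Rle_trans; [apply Cmod_triangle|]. rewrite Cmod_opp; lra. }
  (* Scaling g by 1 - e brings its value at x strictly inside the disk, as [Schwarz_Pick]
     demands. *)
  assert (Hmain : forall e, 0 < e < 1 -> (1 - e) * d <= kappa * (d + 2 * e)).
  { intros e He. set (lam := 1 - e).
    assert (Hlam : 0 < lam < 1) by (unfold lam; lra).
    assert (Hml : forall c, Cmod (RtoC lam * c)%C = lam * Cmod c)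
      by (intros c; rewrite Cmod_mult, Cmod_R, Rabs_pos_eq; lra).
    assert (Hlg : punctured_Schur L (fun z => RtoC lam * g z)%C).
    { intros z Hz HzL. destruct (Hg z Hz HzL) as [H1 H2]. split.
      - apply C_ex_derive_mult; [apply C_ex_derive_const | exact H1].
      - rewrite Hml. nra. }
    assert (Hlx : Cmod (RtoC lam * g x)%C < 1) by (rewrite Hml; nra).
    assert (Hlx' : Cmod (- (RtoC lam * g x))%C < 1) by now rewrite Cmod_opp.
    assert (Hly : Cmod (RtoC lam * g y)%C <= 1) by (rewrite Hml; nra).
    destruct (Schwarz_Pick L _ x Hlg Hx HxL Hlx y Hy) as [_ H].
    { intros [H | H]; [now apply Hyx | now apply HyL]. }
    rewrite Cmod_div in H by exact HT0. fold kappa in H.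
    assert (Hden := T_denominator_neq_0 _ _ Hlx' Hly).
    unfold T at 1 in H. rewrite Cmod_div in H by exact Hden.
    set (D := Cmod (1 + Cconj (- (lam * g x)) * (lam * g y))%C) in *.
    assert (HD : 0 < D) by now apply Cmod_gt_0.
    replace (lam * g y + - (lam * g x))%C with (RtoC lam * (g y - g x))%C in H by ring.
    rewrite Hml in H. fold d in H.
    assert (H' : lam * d <= kappa * D).
    { apply Rmult_le_reg_r with (/ D * / kappa).
      - apply Rmult_lt_0_compat; now apply Rinv_0_lt_compat.
      - replace (kappa * D * (/ D * / kappa)) with 1 by (field; lra).
        replace (lam * d * (/ D * / kappa)) with (lam * d / D / kappa) by (field; lra).
        exact H. }
    (* As |g x| = 1, the denominator splits into a multiple of g y - g x and a term with the factor
       1 - lam^2 <= 2 e. *)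
    assert (HD2 : D <= d + 2 * e).
    { unfold D.
      assert (Hconj : (g x * Cconj (g x))%C = RtoC 1)
        by (rewrite <- Cmod2_conj, Hgx; f_equal; ring).
      replace (1 + Cconj (- (lam * g x)) * (lam * g y))%C with
        (- (Cconj (g x) * (g y - g x)) + RtoC (1 - lam ^ 2) * (Cconj (g x) * g y))%C.
      - eapply Rle_trans; [apply Cmod_triangle|].
        rewrite Cmod_opp, !Cmod_mult, Cmod_conj, Hgx, Cmod_R. fold d.
        rewrite Rabs_pos_eq by nra. unfold lam. pose proof (Cmod_ge_0 (g y)). nra.
      - rewrite Copp_conj, Cmult_conj.
        replace (Cconj (RtoC lam)) with (RtoC lam)
          by (unfold Cconj, RtoC; simpl; f_equal; ring).
        rewrite RtoC_minus, RtoC_pow.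
        transitivity (g x * Cconj (g x) - RtoC lam ^ 2 * (Cconj (g x) * g y))%C; [ring|].
        rewrite Hconj. ring. }
    apply Rle_trans with (1 := H'). apply Rmult_le_compat_l; lra. }
  assert (Hd : d = 0).
  { apply Rle_antisym; [|exact Hd0]. apply Rnot_lt_le; intros Hpos.
    (* [Hmain] with d <= 2 gives (1 - kappa) d <= 4 e, whereas this choice makes it 8 e. *)
    set (e := (1 - kappa) * d / 8).
    assert (He : 0 < e < 1) by (unfold e; nra).
    specialize (Hmain e He).
    assert (e * d <= e * 2) by (apply Rmult_le_compat_l; lra).
    assert (kappa * e <= 1 * e) by (apply Rmult_le_compat_r; lra).
    assert ((1 - kappa) * d = 8 * e) by (unfold e; field).
    lra. }
  apply Cmod_eq_0 in Hd. replace (g y) with ((g y - g x) + g x)%C by ring.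
  rewrite Hd; ring.
Qed.

(** * The Moebius image of the disk *)

Section Moebius_disk.
Variables p q r s : C.
Hypothesis Hrs : Cmod r < Cmod s.

Let Q := Cmod s ^ 2 - Cmod r ^ 2.
(** The map is e |-> (p e + q) / (r e + s). Its centre [c] is the image of - conj r / conj s, the
    reflection of the pole - s / r in the unit circle. *)
Let c := ((Cconj s * q - Cconj r * p) / RtoC Q)%C.
Let rho := Cmod (p * s - q * r)%C / Q.

Let Q_pos : 0 < Q.
Proof. unfold Q. pose proof (Cmod_ge_0 r). nra. Qed.

Lemma Moebius_denominator_neq_0 (e : C) : Cmod e <= 1 -> (r * e + s)%C <> 0.
Proof.
  intros He. apply Cmod_gt_0.
  pose proof (Cmod_triangle (r * e + s) (- (r * e)))%C as H.
  replace (r * e + s + - (r * e))%C with s in H by ring.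
  rewrite Cmod_opp, Cmod_mult in H. pose proof (Cmod_ge_0 r). nra.
Qed.

(** The point v - c equals (p s - q r)(conj s e + conj r) / (Q (r e + s)), so [Moebius_modulus]
    makes rho^2 - |v - c|^2 a nonnegative multiple of 1 - |e|^2. Disk and circle are both read off
    from this. *)
Lemma Moebius_centered (e v : C) : Cmod e <= 1 -> (v * (r * e + s) = p * e + q)%C ->
  (Q * Cmod (r * e + s)%C) ^ 2 * (rho ^ 2 - Cmod (v - c)%C ^ 2) =
  Cmod (p * s - q * r)%C ^ 2 * (Q * (1 - Cmod e ^ 2)).
Proof.
  intros He Hv. assert (Hd := Moebius_denominator_neq_0 e He).
  assert (HQ : RtoC Q <> 0) by (intros H; apply RtoC_inj in H; lra).
  assert (H : ((v - c) * (RtoC Q * (r * e + s)) =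
    (p * s - q * r) * (Cconj s * e + Cconj r))%C).
  { transitivity (RtoC Q * (v * (r * e + s)) - (RtoC Q * c) * (r * e + s))%C; [ring|].
    rewrite Hv. replace (RtoC Q * c)%C with (Cconj s * q - Cconj r * p)%C
      by (unfold c; field; exact HQ).
    unfold Q. rewrite RtoC_minus, !Cmod2_conj. ring. }
  apply (f_equal Cmod) in H. rewrite !Cmod_mult, Cmod_R, Rabs_pos_eq in H by lra.
  pose proof (Moebius_modulus r s e) as Hm.
  rewrite (Cplus_comm s) in Hm. fold Q in Hm.
  assert (Hr : (Q * Cmod (r * e + s)%C) ^ 2 * rho ^ 2 =
    Cmod (p * s - q * r)%C ^ 2 * Cmod (r * e + s)%C ^ 2) by (unfold rho; field; lra).
  rewrite Rmult_minus_distr_l, Hr, <- Hm.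
  apply (f_equal (fun u => u ^ 2)) in H. cbv beta in H.
  replace ((Q * Cmod (r * e + s)%C) ^ 2 * Cmod (v - c)%C ^ 2)
    with ((Cmod (v - c)%C * (Q * Cmod (r * e + s)%C)) ^ 2) by ring.
  rewrite H. ring.
Qed.

Let rho_pos : (p * s - q * r)%C <> 0 -> 0 < rho.
Proof. intros H. apply Rdiv_lt_0_compat; [now apply Cmod_gt_0 | exact Q_pos]. Qed.

Lemma Moebius_disk_in (e v : C) : Cmod e <= 1 -> (v * (r * e + s) = p * e + q)%C ->
  closed_disk c rho v.
Proof.
  intros He Hv. pose proof (Moebius_centered e v He Hv) as H.
  assert (Hd := proj1 (Cmod_gt_0 _) (Moebius_denominator_neq_0 e He)).
  assert (Hr : 0 <= rho) by (apply Rdiv_le_0_compat; [apply Cmod_ge_0 | exact Q_pos]).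
  apply Cmod_le_1_pow2 in He.
  assert (H1 : 0 <= rho ^ 2 - Cmod (v - c)%C ^ 2).
  { apply Rmult_le_reg_l with ((Q * Cmod (r * e + s)%C) ^ 2).
    - apply pow_lt, Rmult_lt_0_compat; [exact Q_pos | exact Hd].
    - rewrite H, Rmult_0_r. apply Rmult_le_pos; [apply pow2_ge_0|].
      apply Rmult_le_pos; [apply Rlt_le, Q_pos | exact He]. }
  unfold closed_disk. pose proof (Cmod_ge_0 (v - c)%C). nra.
Qed.

Lemma Moebius_circle (e v : C) : (p * s - q * r)%C <> 0 ->
  Cmod e <= 1 -> (v * (r * e + s) = p * e + q)%C ->
  circle c rho v <-> unit_circle e.
Proof.
  intros H0 He Hv. pose proof (Moebius_centered e v He Hv) as H.
  assert (Hd := proj1 (Cmod_gt_0 _) (Moebius_denominator_neq_0 e He)).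
  assert (Hr := rho_pos H0). apply Cmod_gt_0 in H0.
  assert (H1 : 0 < (Q * Cmod (r * e + s)%C) ^ 2)
    by (apply pow_lt, Rmult_lt_0_compat; [exact Q_pos | exact Hd]).
  assert (H2 : 0 < Cmod (p * s - q * r)%C ^ 2 * Q)
    by (apply Rmult_lt_0_compat; [now apply pow_lt | exact Q_pos]).
  rewrite <- Rmult_assoc in H.
  pose proof (Cmod_ge_0 (v - c)%C). pose proof (Cmod_ge_0 e).
  unfold circle, unit_circle. split; intros E; rewrite E in H.
  - assert (E0 : 1 - Cmod e ^ 2 = 0) by (apply Rmult_eq_reg_l with (2 := Rgt_not_eq _ _ H2); lra).
    nra.
  - assert (E0 : rho ^ 2 - Cmod (v - c)%C ^ 2 = 0)
      by (apply Rmult_eq_reg_l with (2 := Rgt_not_eq _ _ H1); lra).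
    nra.
Qed.

Lemma Moebius_disk_onto (v : C) : (p * s - q * r)%C <> 0 -> closed_disk c rho v ->
  exists e, Cmod e <= 1 /\ (v * (r * e + s) = p * e + q)%C.
Proof.
  intros H0 Hv. assert (Hr := rho_pos H0).
  set (D := (p * s - q * r)%C) in *.
  assert (HQ : RtoC Q <> 0) by (intros H; apply RtoC_inj in H; lra).
  set (u := ((v - c) * RtoC Q / D)%C).
  assert (Hu : Cmod u <= 1).
  { unfold u. rewrite Cmod_div, Cmod_mult, Cmod_R, Rabs_pos_eq by (exact H0 || lra).
    apply Cmod_gt_0 in H0. apply Rle_div_l; [exact H0|]. rewrite Rmult_1_l.
    apply Rle_trans with (rho * Q).
    - apply Rmult_le_compat_r; [lra | exact Hv].
    - unfold rho. right. field. lra. }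
  assert (Hden : (Cconj s - r * u)%C <> 0).
  { intros H. assert (Hs : Cconj s = (r * u)%C)
      by (replace (Cconj s) with ((Cconj s - r * u) + r * u)%C by ring; rewrite H; ring).
    apply (f_equal Cmod) in Hs. rewrite Cmod_conj, Cmod_mult in Hs.
    pose proof (Cmod_ge_0 r). nra. }
  (* This solves u = (conj s e + conj r) / (r e + s) for e; the inverse has the same form, with - r
     and conj s, hence the same Q. *)
  exists ((s * u - Cconj r) / (Cconj s - r * u))%C. split.
  - rewrite Cmod_div by exact Hden. apply Cmod_gt_0 in Hden.
    apply Rle_div_l; [exact Hden|]. rewrite Rmult_1_l.
    pose proof (Moebius_modulus (- r) (Cconj s) u) as Hm.
    rewrite Cmod_opp, Cmod_conj, Cconj_conj, Copp_conj in Hm. fold Q in Hm.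
    replace (Cconj s + - r * u)%C with (Cconj s - r * u)%C in Hm by ring.
    replace (s * u + - Cconj r)%C with (s * u - Cconj r)%C in Hm by ring.
    apply Cmod_le_1_pow2 in Hu.
    assert (0 <= Q * (1 - Cmod u ^ 2)) by (apply Rmult_le_pos; lra).
    pose proof (Cmod_ge_0 (s * u - Cconj r)%C). nra.
  - assert (Hv' : v = (c + u * D / RtoC Q)%C) by (unfold u; field; auto).
    assert (HQc : RtoC Q = (s * Cconj s - r * Cconj r)%C)
      by (unfold Q; now rewrite RtoC_minus, !Cmod2_conj).
    rewrite Hv'. unfold c, D. rewrite HQc in *. field. auto.
Qed.

End Moebius_disk.

(** * Recursions for the matrix entries *)

Lemma coeff_Mmult_2 (M N : @matrix C 2 2) (i j : nat) : (i < 2)%nat -> (j < 2)%nat ->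
  coeff_mat (RtoC 0) (@Mmult C_Ring 2 2 2 M N) i j =
  (coeff_mat (RtoC 0) M i 0 * coeff_mat (RtoC 0) N 0 j +
   coeff_mat (RtoC 0) M i 1 * coeff_mat (RtoC 0) N 1 j)%C.
Proof.
  intros Hi Hj. unfold Mmult. rewrite (coeff_mat_bij (T := C)) by assumption.
  simpl pred. rewrite sum_Sn, sum_O. reflexivity.
Qed.

Lemma A_S (z w : nat -> C) (k : nat) (x : C) : A z w (S k) x =
  (T (- z (S k)) x * A z w k x + Cconj (gamma z w (S k)) * B z w k x)%C.
Proof. unfold A, B. cbn [AB]. now rewrite coeff_Mmult_2 by lia. Qed.

Lemma At_S (z w : nat -> C) (k : nat) (x : C) : At z w (S k) x =
  (T (- z (S k)) x * At z w k x + Cconj (gamma z w (S k)) * Bt z w k x)%C.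
Proof. unfold At, Bt. cbn [AB]. now rewrite coeff_Mmult_2 by lia. Qed.

Lemma B_S (z w : nat -> C) (k : nat) (x : C) : B z w (S k) x =
  (T (- z (S k)) x * gamma z w (S k) * A z w k x + B z w k x)%C.
Proof.
  rewrite <- (Cmult_1_l (B z w k x)). unfold A, B. cbn [AB].
  now rewrite coeff_Mmult_2 by lia.
Qed.

Lemma Bt_S (z w : nat -> C) (k : nat) (x : C) : Bt z w (S k) x =
  (T (- z (S k)) x * gamma z w (S k) * At z w k x + Bt z w k x)%C.
Proof.
  rewrite <- (Cmult_1_l (Bt z w k x)). unfold At, Bt. cbn [AB].
  now rewrite coeff_Mmult_2 by lia.
Qed.

(** * The Schur algorithm *)

(** [layers] recurses on the outermost layer, whereas passing from [AB] at k to k + 1 inserts an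
    innermost one. *)
Lemma layers_snoc (z w : nat -> C) (e x : C) (m k : nat) :
  layers z w e x (S m) k =
  layers z w (T (gamma z w (k + m)) (T (- z (S (k + m))) x * e)) x m k.
Proof.
  revert k. induction m as [|m IH]; intros k.
  - simpl. now rewrite Nat.add_0_r.
  - change (layers z w e x (S (S m)) k) with
      (T (gamma z w k) (T (- z (S k)) x * layers z w e x (S m) (S k)))%C.
    rewrite IH. replace (S k + m)%nat with (k + S m)%nat by lia. reflexivity.
Qed.

Section Schur_algorithm.
Variables (n : nat) (z w : nat -> C).
Hypothesis hz : forall j : nat, (1 <= j <= n + 1)%nat -> unit_disk (z j).
Hypothesis hdist : forall i j : nat, (1 <= i <= n + 1)%nat -> (1 <= j <= n + 1)%nat ->
  i <> j -> z i <> z j.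
Hypothesis hDelta : forall k j : nat, (0 <= k < j)%nat -> (j <= n + 1)%nat ->
  ext_in_unit_disk (hdd z w k j).

Let delta (k j : nat) : C := ext_val (hdd z w k j).

Lemma hdd_step_finite (zj zk dj dk : C) : unit_disk dj ->
  ext_in_unit_disk (hdd_step zj zk dj dk) ->
  ext_val (hdd_step zj zk dj dk) = (ext_val (bracket dj dk) / ext_val (bracket zj zk))%C.
Proof.
  intros Hdj. unfold hdd_step.
  destruct (Rbar_le_dec _ _); [reflexivity|].
  destruct (Ceq_dec dj dk); [|intros []].
  destruct (Req_EM_T (Cmod dj) 1); [|intros []].
  unfold unit_disk in Hdj; lra.
Qed.

Lemma bracket_T (a b : C) : unit_disk a -> unit_disk b -> ext_val (bracket a b) = T (- b) a.
Proof.
  unfold unit_disk, bracket; intros Ha Hb. destruct (Ceq_dec _ _) as [H | H].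
  - apply (f_equal Cmod) in H. rewrite Cmod_mult, Cmod_conj, Cmod_1 in H.
    pose proof (Cmod_ge_0 a). pose proof (Cmod_ge_0 b). nra.
  - unfold T; simpl. rewrite Copp_conj. f_equal; ring.
Qed.

Lemma delta_unit_disk (k j : nat) : (k < j <= n + 1)%nat -> unit_disk (delta k j).
Proof.
  intros H. specialize (hDelta k j ltac:(lia) ltac:(lia)). unfold delta.
  destruct (hdd z w k j); [exact hDelta | destruct hDelta].
Qed.

Lemma gamma_unit_disk (k : nat) : (k <= n)%nat -> Cmod (gamma z w k) < 1.
Proof. intros H. apply (delta_unit_disk k (S k)). lia. Qed.

(** This is the Schur step evaluated at a later node: the values of the iterates at the remaining
    nodes are determined by the data alone. *)
Lemma delta_S (k j : nat) : (S k < j <= n + 1)%nat ->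
  delta (S k) j = (T (- gamma z w k) (delta k j) / T (- z (S k)) (z j))%C.
Proof.
  intros H.
  assert (H1 := delta_unit_disk k j ltac:(lia)).
  assert (H2 := gamma_unit_disk k ltac:(lia)).
  assert (H3 := hDelta (S k) j ltac:(lia) ltac:(lia)).
  unfold delta, gamma in *. cbn [hdd] in *.
  destruct (hdd z w k j) as [dj|]; [|destruct H3].
  destruct (hdd z w k (S k)) as [dk|]; [|destruct H3].
  rewrite hdd_step_finite by assumption. simpl ext_val in *.
  rewrite !bracket_T; auto; apply hz; lia.
Qed.

(** Reversed so that the newest node is at the head, as in the conclusion of [Schwarz_Pick]. *)
Definition nodes (k : nat) : list C := map z (rev (seq 1 k)).

Lemma nodes_S (k : nat) : nodes (S k) = z (S k) :: nodes k.
Proof.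
  unfold nodes. rewrite seq_S, rev_app_distr. reflexivity.
Qed.

Lemma In_nodes (k : nat) (y : C) :
  In y (nodes k) <-> exists j, (1 <= j <= k)%nat /\ y = z j.
Proof.
  unfold nodes. rewrite in_map_iff. split.
  - intros [j [Hj Hin]]. apply in_rev, in_seq in Hin. exists j; split; [lia | auto].
  - intros [j [Hj Hy]]. exists j; split; [auto|]. apply -> in_rev. apply in_seq. lia.
Qed.

Lemma next_node (k : nat) : (k <= n)%nat -> unit_disk (z (S k)) /\ ~ In (z (S k)) (nodes k).
Proof.
  intros Hk. split; [apply hz; lia|].
  intros H. apply In_nodes in H as [j [Hj H]]. revert H. apply hdist; lia.
Qed.

Fixpoint Schur_iterate (f : C -> C) (k : nat) : C -> C :=
  match k with
  | O => f
  | S k' => fun y => (T (- gamma z w k') (Schur_iterate f k' y) / T (- z k) y)%C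
  end.

(** The two parts need a joint induction: [Schur_iterate] subtracts [gamma], and [Schwarz_Pick]
    applies because this is the value of the iterate at the next node. *)
Lemma Schur_iterate_spec (f : C -> C) : Schur f -> interpolates z w n f ->
  forall k, (k <= n + 1)%nat ->
    punctured_Schur (nodes k) (Schur_iterate f k) /\
    forall j, (k < j <= n + 1)%nat -> Schur_iterate f k (z j) = delta k j.
Proof.
  intros Hf Hint. induction k as [|k IH]; intros Hk.
  - split.
    + intros y Hy _. now apply Hf.
    + intros j Hj. apply Hint. lia.
  - destruct (IH ltac:(lia)) as [IH1 IH2]; clear IH.
    destruct (next_node k ltac:(lia)) as [Hz HzL].
    assert (Hg : Schur_iterate f k (z (S k)) = gamma z w k) by (apply IH2; lia).
    split.
    + rewrite nodes_S. cbn [Schur_iterate]. rewrite <- Hg.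
      apply Schwarz_Pick; auto. rewrite Hg. apply gamma_unit_disk; lia.
    + intros j Hj. cbn [Schur_iterate]. rewrite IH2 by lia. symmetry. now apply delta_S.
Qed.

Lemma layers_Schur_iterate (f : C -> C) (y : C) : Schur f -> interpolates z w n f ->
  unit_disk y -> ~ In y (nodes (n + 1)) ->
  forall m k, (k + m <= n + 1)%nat ->
    Schur_iterate f k y = layers z w (Schur_iterate f (k + m) y) y m k.
Proof.
  intros Hf Hint Hy HyL. induction m as [|m IH]; intros k Hk.
  - now rewrite Nat.add_0_r.
  - cbn [layers]. replace (k + S m)%nat with (S k + m)%nat by lia.
    rewrite <- IH by lia. cbn [Schur_iterate].
    assert (Hny : forall k', (k' <= n + 1)%nat -> ~ In y (nodes k')).
    { intros k' Hk' H. apply HyL, In_nodes. apply In_nodes in H as [j [Hj H]].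
      exists j; split; [lia | exact H]. }
    destruct (Schur_iterate_spec f Hf Hint k ltac:(lia)) as [Hs _].
    destruct (Hs y Hy (Hny k ltac:(lia))) as [_ Hle].
    assert (HT : T (- z (S k)) y <> 0).
    { apply T_opp_neq_0; [apply hz; lia | now apply Rlt_le|].
      intros ->. apply (Hny (S k) ltac:(lia)). rewrite nodes_S. now left. }
    replace (T (- z (S k)) y * (T (- gamma z w k) (Schur_iterate f k y) / T (- z (S k)) y))%C
      with (T (- gamma z w k) (Schur_iterate f k y)) by (field; exact HT).
    symmetry. apply T_opp_r; [apply gamma_unit_disk; lia | exact Hle].
Qed.

Lemma T_node (k : nat) (y : C) : (k <= n)%nat -> unit_disk y -> Cmod (T (- z (S k)) y) < 1.
Proof.
  intros Hk Hy. apply T_open; [|exact Hy]. rewrite Cmod_opp. apply hz. lia.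
Qed.

Lemma layers_closed (e y : C) : Cmod e <= 1 -> unit_disk y ->
  forall m k, (k + m <= n + 1)%nat -> Cmod (layers z w e y m k) <= 1.
Proof.
  intros He Hy. induction m as [|m IH]; intros k Hk; [exact He|].
  cbn [layers]. apply T_closed; [apply gamma_unit_disk; lia|].
  rewrite Cmod_mult. specialize (IH (S k) ltac:(lia)).
  pose proof (T_node k y ltac:(lia) Hy).
  pose proof (Cmod_ge_0 (T (- z (S k)) y)). pose proof (Cmod_ge_0 (layers z w e y m (S k))).
  nra.
Qed.

Lemma C_ex_derive_layers (e y : C) : Cmod e <= 1 -> unit_disk y ->
  forall m k, (k + m <= n + 1)%nat -> C_ex_derive (fun y => layers z w e y m k) y.
Proof.
  intros He Hy. induction m as [|m IH]; intros k Hk.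
  - exact (C_ex_derive_const e y).
  - cbn [layers].
    apply (C_ex_derive_comp (T (gamma z w k))
      (fun y => T (- z (S k)) y * layers z w e y m (S k))%C).
    + apply C_ex_derive_T; [apply gamma_unit_disk; lia|].
      rewrite Cmod_mult. pose proof (T_node k y ltac:(lia) Hy).
      pose proof (layers_closed e y He Hy m (S k) ltac:(lia)).
      pose proof (Cmod_ge_0 (T (- z (S k)) y)).
      pose proof (Cmod_ge_0 (layers z w e y m (S k))). nra.
    + apply C_ex_derive_mult; [|apply IH; lia].
      apply C_ex_derive_T; [|now apply Rlt_le]. rewrite Cmod_opp. apply hz. lia.
Qed.

(** At z_(k+1) the factor T_(-z_(k+1)) kills the inner layers and leaves [gamma] at k; at later
    nodes the outer layer undoes the quotient in [delta_S]. *)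
Lemma layers_interpolate (e : C) : forall m k, (k + m = n + 1)%nat ->
  forall j, (k < j <= n + 1)%nat -> layers z w e (z j) m k = delta k j.
Proof.
  induction m as [|m IH]; intros k Hk j Hj; [lia|].
  cbn [layers]. destruct (Nat.eq_dec j (S k)) as [-> | Hne].
  - rewrite T_opp_self, Cmult_0_l, T_0. reflexivity.
  - rewrite IH by lia. rewrite delta_S by lia.
    replace (T (- z (S k)) (z j) * (T (- gamma z w k) (delta k j) / T (- z (S k)) (z j)))%C
      with (T (- gamma z w k) (delta k j)).
    + apply T_opp_r; [apply gamma_unit_disk; lia|]. apply Rlt_le, delta_unit_disk; lia.
    + field. apply T_opp_neq_0; [apply hz; lia | apply Rlt_le, hz; lia | apply hdist; lia].
Qed.

Lemma f_eps_Schur (e : C) : closed_unit_disk e -> Schur (f_eps z w n e).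
Proof.
  intros He y Hy. split.
  - apply C_ex_derive_layers; auto; lia.
  - apply layers_closed; auto; lia.
Qed.

Lemma f_eps_interpolates (e : C) : interpolates z w n (f_eps z w n e).
Proof. intros j Hj. apply (layers_interpolate e (S n) 0); lia. Qed.

(** * The disk of values at a fixed point *)

Section Values.
Variable x : C.
Hypothesis Hx : unit_disk x.
Hypothesis Hxz : forall j : nat, (1 <= j <= n + 1)%nat -> x <> z j.

Let t (k : nat) : C := T (- z (S k)) x.

(** One step turns |B|^2 - |t A|^2 into the next |B|^2 - |A|^2 up to the factor 1 - |gamma|^2. The
    inequality puts the pole outside the closed disk and makes [denom] positive. *)
Lemma Cmod_A_lt_Cmod_B (k : nat) : (k <= n)%nat -> Cmod (A z w k x) < Cmod (B z w k x).
Proof.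
  induction k as [|k IH]; intros Hk.
  - change (Cmod (Cconj (gamma z w 0)) < Cmod 1). rewrite Cmod_conj, Cmod_1.
    now apply gamma_unit_disk.
  - specialize (IH ltac:(lia)). rewrite A_S, B_S.
    change (T (- z (S k)) x) with (t k).
    pose proof (gamma_unit_disk (S k) Hk) as Hg. apply Cmod_lt_1_pow2 in Hg.
    pose proof (T_node k x ltac:(lia) Hx) as Ht. change (T (- z (S k)) x) with (t k) in Ht.
    set (a := A z w k x) in *. set (b := B z w k x) in *. set (g := gamma z w (S k)) in *.
    assert (H : Cmod (t k * g * a + b)%C ^ 2 - Cmod (t k * a + Cconj g * b)%C ^ 2 =
      (1 - Cmod g ^ 2) * (Cmod b ^ 2 - Cmod (t k * a)%C ^ 2)).
    { rewrite !Cmod2_alt. destruct g, a, b, (t k).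
      unfold Re, Im, Cplus, Cmult, Cconj; simpl. ring. }
    rewrite Cmod_mult in H.
    assert (Hta : Cmod (t k) * Cmod a < Cmod b).
    { pose proof (Cmod_ge_0 a). pose proof (Cmod_ge_0 (t k)). nra. }
    assert (H0 : 0 <= Cmod (t k) * Cmod a)
      by (apply Rmult_le_pos; apply Cmod_ge_0).
    assert (H1 : 0 < (1 - Cmod g ^ 2) * (Cmod b ^ 2 - (Cmod (t k) * Cmod a) ^ 2))
      by (apply Rmult_lt_0_compat; [exact Hg | nra]).
    pose proof (Cmod_ge_0 (t k * g * a + b)%C).
    pose proof (Cmod_ge_0 (t k * a + Cconj g * b)%C). nra.
Qed.

(** Inserting an innermost layer replaces e by a Moebius image of it, that is, composes the
    corresponding matrices. The cross-multiplied form needs only the denominator [d] of the new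
    layer to be nonzero. *)
Lemma layers_Moebius (k : nat) : (k <= n)%nat -> forall e, Cmod e <= 1 ->
  (layers z w e x (S k) 0 * (t k * A z w k x * e + B z w k x) =
   t k * At z w k x * e + Bt z w k x)%C.
Proof.
  assert (Hstep : forall i e, (i <= n)%nat -> Cmod e <= 1 -> Cmod (t i * e)%C <= 1).
  { intros i e Hi He. rewrite Cmod_mult. pose proof (T_node i x Hi Hx) as Ht.
    change (T (- z (S i)) x) with (t i) in Ht.
    pose proof (Cmod_ge_0 (t i)). pose proof (Cmod_ge_0 e). nra. }
  induction k as [|k IH]; intros Hk e He.
  - change (A z w 0 x) with (Cconj (gamma z w 0)). change (B z w 0 x) with (RtoC 1).
    change (At z w 0 x) with (RtoC 1). change (Bt z w 0 x) with (gamma z w 0).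
    cbn [layers]. change (T (- z 1%nat) x) with (t 0). unfold T at 1.
    field. apply T_denominator_neq_0; [now apply gamma_unit_disk | now apply Hstep].
  - rewrite layers_snoc. simpl (0 + S k)%nat. change (T (- z (S (S k))) x) with (t (S k)).
    set (e' := T (gamma z w (S k)) (t (S k) * e)).
    assert (Hg := gamma_unit_disk (S k) Hk).
    assert (Hte := Hstep (S k) e Hk He).
    assert (He' : Cmod e' <= 1) by now apply T_closed.
    assert (Hden := T_denominator_neq_0 _ _ Hg Hte).
    specialize (IH ltac:(lia) e' He').
    rewrite A_S, At_S, B_S, Bt_S. change (T (- z (S k)) x) with (t k).
    set (d := (1 + Cconj (gamma z w (S k)) * (t (S k) * e))%C) in *.
    assert (He'd : (e' * d = t (S k) * e + gamma z w (S k))%C)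
      by (unfold e', d, T; field; exact Hden).
    transitivity (layers z w e' x (S k) 0 * (t k * A z w k x * (e' * d) + B z w k x * d))%C.
    { rewrite He'd. unfold d. ring. }
    transitivity ((t k * At z w k x * e' + Bt z w k x) * d)%C.
    { rewrite <- IH. ring. }
    transitivity (t k * At z w k x * (e' * d) + Bt z w k x * d)%C; [ring|].
    rewrite He'd. unfold d. ring.
Qed.

(** The matrix of step k + 1 has determinant t_k (1 - |gamma_(k+1)|^2); the remaining factor is the
    t of the innermost variable. *)
Lemma Moebius_determinant (k : nat) : (k <= n)%nat ->
  Cmod (t k * At z w k x * B z w k x - Bt z w k x * (t k * A z w k x))%C =
  prod_f_R0 (fun k => Cmod (t k) * (1 - Cmod (gamma z w k) ^ 2)) k.
Proof.
  assert (Hpos : forall i, (i <= n)%nat -> 0 <= 1 - Cmod (gamma z w i) ^ 2)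
    by (intros i Hi; apply Rlt_le, Cmod_lt_1_pow2, gamma_unit_disk, Hi).
  assert (Hreal : forall g, (1 - Cconj g * g)%C = RtoC (1 - Cmod g ^ 2)).
  { intros g. rewrite RtoC_minus, Cmod2_conj. ring. }
  induction k as [|k IH]; intros Hk.
  - change (A z w 0 x) with (Cconj (gamma z w 0)). change (B z w 0 x) with (RtoC 1).
    change (At z w 0 x) with (RtoC 1). change (Bt z w 0 x) with (gamma z w 0).
    replace (t 0 * 1 * 1 - gamma z w 0 * (t 0 * Cconj (gamma z w 0)))%C
      with (t 0 * (1 - Cconj (gamma z w 0) * gamma z w 0))%C by ring.
    rewrite Hreal, Cmod_mult, Cmod_R, Rabs_pos_eq by now apply Hpos. reflexivity.
  - cbn [prod_f_R0]. rewrite <- IH by lia. rewrite A_S, At_S, B_S, Bt_S.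
    change (T (- z (S k)) x) with (t k).
    rewrite <- (Rabs_pos_eq _ (Hpos (S k) Hk)), <- Cmod_R, <- Hreal, <- !Cmod_mult.
    f_equal. ring.
Qed.

Lemma t_neq_0 (k : nat) : (k <= n)%nat -> t k <> 0.
Proof.
  intros Hk. apply T_opp_neq_0; [apply hz; lia | now apply Rlt_le | apply Hxz; lia].
Qed.

Let p := (t n * At z w n x)%C.
Let q := Bt z w n x.
Let r := (t n * A z w n x)%C.
Let s := B z w n x.

Lemma value_disk_nondegenerate : (p * s - q * r)%C <> 0.
Proof.
  apply Cmod_gt_0. unfold p, q, r, s. rewrite Moebius_determinant by lia.
  assert (Hpos : forall k, (k <= n)%nat -> 0 < Cmod (t k) * (1 - Cmod (gamma z w k) ^ 2)).
  { intros k Hk. apply Rmult_lt_0_compat.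
    - now apply Cmod_gt_0, t_neq_0.
    - now apply Cmod_lt_1_pow2, gamma_unit_disk. }
  assert (H : forall k, (k <= n)%nat ->
    0 < prod_f_R0 (fun k => Cmod (t k) * (1 - Cmod (gamma z w k) ^ 2)) k).
  { induction k as [|k IH]; intros Hk; cbn [prod_f_R0].
    - now apply Hpos.
    - apply Rmult_lt_0_compat; [apply IH; lia | now apply Hpos]. }
  apply H; lia.
Qed.

Lemma value_disk_pole : Cmod r < Cmod s.
Proof.
  unfold r, s. rewrite Cmod_mult.
  pose proof (Cmod_A_lt_Cmod_B n (le_n n)).
  pose proof (T_node n x (le_n n) Hx) as Ht. change (T (- z (S n)) x) with (t n) in Ht.
  pose proof (Cmod_ge_0 (A z w n x)). pose proof (Cmod_ge_0 (t n)). nra.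
Qed.

Lemma denom_eq : denom z w n x = Cmod s ^ 2 - Cmod r ^ 2.
Proof. unfold denom, r, s. rewrite Cmod_mult. change (T (- z (S n)) x) with (t n). ring. Qed.

Lemma center_eq : center z w n x =
  ((Cconj s * q - Cconj r * p) / RtoC (Cmod s ^ 2 - Cmod r ^ 2))%C.
Proof.
  unfold center. rewrite denom_eq. f_equal.
  change (T (- z (S n)) x) with (t n). unfold p, q, r, s.
  rewrite Cmod2_conj, Cmult_conj. ring.
Qed.

Lemma radius_eq : radius z w n x = Cmod (p * s - q * r)%C / (Cmod s ^ 2 - Cmod r ^ 2).
Proof.
  unfold radius. rewrite denom_eq. f_equal. symmetry. now apply Moebius_determinant.
Qed.

Lemma f_eps_closed_disk (v : C) :
  closed_disk (center z w n x) (radius z w n x) v <->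
  exists e, closed_unit_disk e /\ f_eps z w n e x = v.
Proof.
  rewrite center_eq, radius_eq. split.
  - intros Hv.
    destruct (Moebius_disk_onto p q r s value_disk_pole v value_disk_nondegenerate Hv)
      as [e [He H]].
    exists e; split; [exact He|].
    pose proof (layers_Moebius n (le_n n) e He) as H'.
    fold p q r s in H'. rewrite <- H in H'.
    assert (H0 := Moebius_denominator_neq_0 r s value_disk_pole e He).
    unfold f_eps.
    replace v with (v * (r * e + s) / (r * e + s))%C by (field; exact H0).
    rewrite <- H'. field. exact H0.
  - intros [e [He <-]]. apply (Moebius_disk_in p q r s value_disk_pole e); [exact He|].
    now apply layers_Moebius.
Qed.

Lemma f_eps_circle (e : C) : closed_unit_disk e ->
  circle (center z w n x) (radius z w n x) (f_eps z w n e x) <-> unit_circle e.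
Proof.
  intros He. rewrite center_eq, radius_eq.
  apply Moebius_circle;
    [exact value_disk_pole | exact value_disk_nondegenerate | exact He|].
  now apply layers_Moebius.
Qed.

Lemma not_node : ~ In x (nodes (n + 1)).
Proof. intros H. apply In_nodes in H as [j [Hj H]]. now apply (Hxz j Hj). Qed.

End Values.

Lemma f_eps_last_iterate (f : C -> C) (y : C) : Schur f -> interpolates z w n f ->
  unit_disk y -> ~ In y (nodes (n + 1)) ->
  f y = f_eps z w n (Schur_iterate f (n + 1) y) y.
Proof.
  intros Hf Hint Hy HyL. rewrite Nat.add_1_r.
  apply (layers_Schur_iterate f y Hf Hint Hy HyL (S n) 0). lia.
Qed.

End Schur_algorithm.

Theorem theorem2p1 (n : nat) (z w : nat -> C)
  (hz : forall j : nat, (1 <= j <= n + 1)%nat -> unit_disk (z j))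
  (hdist : forall i j : nat, (1 <= i <= n + 1)%nat -> (1 <= j <= n + 1)%nat ->
     i <> j -> z i <> z j)
  (hw : forall j : nat, (1 <= j <= n + 1)%nat -> closed_unit_disk (w j))
  (hDelta : forall k j : nat, (0 <= k < j)%nat -> (j <= n + 1)%nat ->
     ext_in_unit_disk (hdd z w k j)) :
  forall x : C, unit_disk x ->
  (forall j : nat, (1 <= j <= n + 1)%nat -> x <> z j) ->
    (forall v : C,
       (exists f : C -> C, Schur f /\ interpolates z w n f /\ f x = v) <->
       closed_disk (center z w n x) (radius z w n x) v) /\
    (forall v : C,
       closed_disk (center z w n x) (radius z w n x) v <->
       (exists eps : C, closed_unit_disk eps /\ f_eps z w n eps x = v)) /\
    (forall f : C -> C, Schur f -> interpolates z w n f ->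
       (circle (center z w n x) (radius z w n x) (f x) <->
        exists eps : C, unit_circle eps /\
          (forall y : C, unit_disk y -> f y = f_eps z w n eps y))).
Proof.
  intros x Hx Hxz.
  assert (HxL : ~ In x (nodes z (n + 1))) by now apply not_node.
  assert (Hdisk := f_eps_closed_disk n z w hz hDelta x Hx Hxz).
  assert (Hlast : forall f, Schur f -> interpolates z w n f ->
    punctured_Schur (nodes z (n + 1)) (Schur_iterate z w f (n + 1)))
    by (intros f Hf Hint; now apply (Schur_iterate_spec n)).
  split; [|split; [exact Hdisk|]].
  - intros v. rewrite Hdisk. split.
    + intros [f [Hf [Hint <-]]]. exists (Schur_iterate z w f (n + 1) x). split.
      * now apply Hlast.
      * symmetry. now apply f_eps_last_iterate.
    + intros [e [He <-]]. exists (f_eps z w n e).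
      split; [now apply f_eps_Schur | split; [now apply f_eps_interpolates | reflexivity]].
  - intros f Hf Hint. set (g := Schur_iterate z w f (n + 1)).
    assert (Hg := Hlast f Hf Hint). fold g in Hg.
    assert (Hfg : forall y, unit_disk y -> ~ In y (nodes z (n + 1)) ->
      f y = f_eps z w n (g y) y) by (intros; now apply f_eps_last_iterate).
    split.
    + intros Hc. rewrite (Hfg x Hx HxL) in Hc.
      apply f_eps_circle in Hc; auto; [|now apply Hg].
      exists (g x); split; [exact Hc|]. intros y Hy.
      (* At a node g is uncontrolled, but both functions take the prescribed value there. *)
      destruct (classic (In y (nodes z (n + 1)))) as [HyL | HyL].
      * apply In_nodes in HyL as [j [Hj ->]].
        rewrite (Hint j Hj). symmetry. now apply f_eps_interpolates.
      * rewrite (Hfg y Hy HyL). f_equal.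
        now apply (strong_maximum_principle (nodes z (n + 1))).
    + intros [e [He Heq]]. rewrite (Heq x Hx).
      apply f_eps_circle; auto. unfold closed_unit_disk. rewrite He. lra.
Qed.
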